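(* Let $d\ge 2$ be an integer and let $\lambda>0$. (i) If $\lambda\in\Lambda$, then $0<\rho_c<\rho_e=\lambda(d-1)$; moreover escape occurs at $\rho=\rho_c$ (that is, $P_{\lambda,\rho_c}(A)>0$ and $P_{\lambda,\rho_c}(B)=0$), and extinction occurs at $\rho=\rho_e$ (that is, $P_{\lambda,\rho_e}(A)=0$). (ii) If $\lambda\notin\Lambda$, then $0=\rho_c<\rho_e=\lambda(d-1)$, and extinction occurs at $\rho=\rho_e$ (that is, $P_{\lambda,\rho_e}(A)=0$).
   Context: Chase-escape with death (CED) with parameters $\lambda>0$ (spreading rate) and $\rho>0$ (death rate) on a graph is the continuous-time Markov process in which every vertex is in one of the states $w$ (white), $r$ (red), $b$ (blue), $\dagger$ (dead), with the following independent transitions: for each edge with one endpoint red and the other white, the white endpoint becomes red at rate $\lambda$; for each edge with one endpoint blue and the other red, the red endpoint becomes blue at rate $1$; each red vertex becomes dead at rate $\rho$. Blue and dead vertices never change state. The graph considered is the infinite rooted $d$-ary tree $\mathbb T_d$ (every vertex has $d$ children) with one extra vertex $\mathfrak b$ attached to the root. Initially $\mathfrak b$ is blue, the root is red, and all other vertices are white. $P_{\lambda,\rho}$ denotes the law of this process. Let $\mathcal R$ (resp. $\mathcal B$) be the set of vertices that are ever red (resp. ever blue), $A=\{|\mathcal R|=\infty\}$ and $B=\{|\mathcal B|=\infty\}$. Define $\rho_c=\rho_c(d,\lambda)=\inf\{\rho>0: P_{\lambda,\rho}(B)=0\}$ and $\rho_e=\rho_e(d,\lambda)=\inf\{\rho>0: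 P_{\lambda,\rho}(A)=0\}$. Let $\lambda_c^{\pm}=2d-1\pm 2\sqrt{d^2-d}$ and let $\Lambda=(\lambda_c^-,\lambda_c^+)$ (open interval). *)

(* Defs.v *)
From HB Require Import structures.
From mathcomp Require Import all_boot all_order all_algebra.
From mathcomp Require Import finmap.
From mathcomp Require Import all_classical all_reals all_analysis measurable_realfun.

Set Implicit Arguments.
Unset Strict Implicit.
Unset Printing Implicit Defensive.

Import Order.TTheory GRing.Theory Num.Theory.
Import numFieldNormedType.Exports.

Local Open Scope classical_set_scope.
Local Open Scope ring_scope.

Section MarkovChain.
Context {R : realType} {S : choiceType}.
(* [q x y] is the rate of the transition from [x] to [y != x]; it is assumed
   that [q x x = 0] and that every total exit rate is finite. *)
Variable q : S -> S -> R.

Definition exit_rate (x : S) : R := fine (\esum_(y in [set: S]) (q x y)%:E).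

(* A state with exit rate 0 is absorbing. *)
Definition jump_prob (x y : S) : R :=
  if exit_rate x == 0 then (x == y)%:R else q x y / exit_rate x.

(* [X] is a continuous-time Markov chain with rates [q] started at [x0]:
   its successive states [Y n] form a discrete-time Markov chain with transition
   matrix [jump_prob] and, given [Y], the holding times [H n] are independent
   exponential variables with parameters [exit_rate (Y n)].  Holding times are
   extended reals: by the last displayed law, the holding time in an absorbing
   state is +oo almost surely.  The paths are defined at all times, i.e. only
   finitely many jumps take place before any finite time.  Only the times
   [0 <= t] are relevant. *)
Definition is_markov_chain (x0 : S) (disp : measure_display)
    (Omega : measurableType disp) (P : probability Omega R)
    (X : R -> Omega -> S) : Prop :=
  exists (Y : nat -> Omega -> S) (H : nat -> Omega -> \bar R),
    [/\ (forall n x, measurable [set w | Y n w = x]),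
        (forall n, measurable_fun [set: Omega] (H n)),
        (forall n w, (0 < H n w)%E),
        (forall w t, 0 <= t -> exists n,
           [/\ (\sum_(i < n) H i w <= t%:E)%E,
               (t%:E < \sum_(i < n.+1) H i w)%E & X t w = Y n w])
      & (forall (n : nat) (y : nat -> S) (t : nat -> R),
           (forall i, 0 <= t i) ->
           P [set w | (forall i, (i <= n)%N -> Y i w = y i) /\
                      (forall i, (i < n)%N -> ((t i)%:E < H i w)%E)] =
           ((y 0%N == x0)%:R *
            \prod_(i < n) (jump_prob (y i) (y i.+1) *
                           expR (- (exit_rate (y i) * t i))))%:E)].

End MarkovChain.

Inductive vstate := White | Red | Blue | Dead.

Definition vstate_code (s : vstate) : bool * bool :=
  match s with
  | White => (false, false) | Red => (true, false)
  | Blue => (false, true) | Dead => (true, true)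
  end.

Definition vstate_decode (b : bool * bool) : vstate :=
  match b with
  | (false, false) => White | (true, false) => Red
  | (false, true) => Blue | (true, true) => Dead
  end.

Lemma vstate_codeK : cancel vstate_code vstate_decode.
Proof. by case. Qed.

HB.instance Definition _ := Countable.copy vstate (can_type vstate_codeK).

(* Configurations with finitely many non-white vertices. *)
Definition config (V : choiceType) := {fsfun V -> vstate with White}.

Section ChaseEscapeWithDeath.
Context {R : realType} {V : choiceType}.
Variable adj : rel V.
Variables lambda rho : R.
Implicit Types (c : config V) (v : V) (s : vstate).

(* For [s != White], the neighbours of [v] in state [s] all belong to the
   finite support of [c]. *)
Definition nb_count c v s : nat :=
  #|` [fset u in finsupp c | adj u v && (c u == s)]%fset |.

(* Rate at which [v] changes its state to [s] in the configuration [c]; every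
   edge incident to [v] contributes separately. *)
Definition flip_rate c v s : R :=
  match c v, s with
  | White, Red => lambda * (nb_count c v Red)%:R
  | Red, Blue => (nb_count c v Blue)%:R
  | Red, Dead => rho
  | _, _ => 0
  end.

(* Transitions change a single vertex, to a non-white state: if [c != c'], at
   most one [v] contributes to this sum; if [c = c'], all terms vanish. *)
Definition ced_rate (c c' : config V) : R :=
  \sum_(v <- finsupp c' | c' == [fsfun c with v |-> c' v]%fsfun)
     flip_rate c v (c' v).

End ChaseEscapeWithDeath.

(* [Some u] is the tree vertex reached from the root [Some [::]] by reading the
   word [u] from right to left, so the children of [u] are the [i :: u];
   [None] is the extra vertex. *)
Definition tvertex (d : nat) := option (seq 'I_d).

Definition tparent d (u v : tvertex d) : bool :=
  match u, v with
  | None, Some [::] => true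
  | Some u', Some (_ :: v') => u' == v'
  | _, _ => false
  end.

Definition tadj d : rel (tvertex d) :=
  fun u v => tparent u v || tparent v u.

Definition tree_init d : config (tvertex d) :=
  [fsfun [fsfun with White] with (None : tvertex d) |-> Blue,
                                 (Some [::] : tvertex d) |-> Red]%fsfun.

Definition is_CED (R : realType) (d : nat) (lambda rho : R)
    (disp : measure_display) (Omega : measurableType disp)
    (P : probability Omega R) (X : R -> Omega -> config (tvertex d)) : Prop :=
  is_markov_chain (ced_rate (@tadj d) lambda rho) (tree_init d) P X.

Definition ever (R : realType) (d : nat) (Omega : Type)
    (X : R -> Omega -> config (tvertex d)) (s : vstate) (w : Omega)
    : set (tvertex d) :=
  [set v | exists2 t : R, 0 <= t & X t w v = s].

Definition eventA (R : realType) (d : nat) (Omega : Type)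
    (X : R -> Omega -> config (tvertex d)) : set Omega :=
  [set w | infinite_set (ever X Red w)].

Definition eventB (R : realType) (d : nat) (Omega : Type)
    (X : R -> Omega -> config (tvertex d)) : set Omega :=
  [set w | infinite_set (ever X Blue w)].

(* Only meaningful when [p] vanishes somewhere on the positive half-line, since
   the library's [inf] of the empty set is 0. *)
Definition critical_value (R : realType) (p : R -> \bar R) : R :=
  inf [set rho | 0 < rho /\ p rho = 0%E].

Definition lambda_cminus (R : realType) (d : nat) : R :=
  2 * d%:R - 1 - 2 * Num.sqrt (d%:R ^+ 2 - d%:R).

Definition lambda_cplus (R : realType) (d : nat) : R :=
  2 * d%:R - 1 + 2 * Num.sqrt (d%:R ^+ 2 - d%:R).

(* Main.v *)
Require Import Defs.
From mathcomp Require Import all_boot all_order all_algebra.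
From mathcomp Require Import finmap.
From mathcomp Require Import all_classical all_reals all_analysis measurable_realfun.
From mathcomp Require Import ring lra.
Import Order.TTheory GRing.Theory Num.Theory.
Import numFieldNormedType.Exports.
Local Open Scope ring_scope.

Set Implicit Arguments.
Unset Strict Implicit.
Unset Printing Implicit Defensive.

(** Only the jump chain of the process matters. Up to null events, red spreads
    forever when the number of vertices that ever left the state white is
    unbounded along the jump chain, and blue spreads forever when the number of
    blue vertices is unbounded ([prob_unbounded_le], [prob_unbounded_ge]). Both
    counts are nondecreasing, so everything reduces to the probability that a
    count has reached [K] after [n] jumps. These probabilities are obtained by
    iterating the transition operator ([prob_chain]), and they are controlled by
    functions [exp (- pot)] of the configuration along which that operator is
    monotone: bounded submartingales show that a count stays bounded
    ([rare_growth]), bounded supermartingales show that it grows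
    ([likely_growth]). Here [pot] is a linear functional of the configuration, whose
    drift is the growth rate of the underlying branching structure.

    For red, [pot] weighs every edge from a red vertex to a white child equally.
    Such an edge is replaced by [d] new ones at rate [lambda], and disappears
    with its red end at rate [rho] or faster; the drift per edge is at most
    [lambda * (d - 1) - rho]. Hence [rho_e = lambda * (d - 1)]. At the critical
    value the drift vanishes and the second order term of the exponential
    decides for extinction ([red_rare]). Below it, red escapes with positive
    probability, because the root may die while one of its children is red, and
    from then on no red vertex is ever chased ([red_likely]).

    For blue, a white child of a red vertex [y] is weighed according to the
    number [j] of red vertices on the path from [y] up to the nearest blue
    vertex; if a dead vertex comes first, the weight is [0]. On such a path, the
    child becomes red at rate [lambda] and leaves [d] white vertices at
    distance [j + 1], blue advances at rate [1], and one of the [j] red vertices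
    dies at rate [j * rho]. The total weight has no drift when
    [(1 + lambda + j * rho) * w j = w (j - 1) + lambda * d * w (j + 1)] with
    [w 0 = 0]; take [w = shoot 0 rho], the solution with [w 1 = 1]. If it stays
    nonnegative ([viable]), capping it gives bounded weights with nonpositive
    drift, and blue dies out, also in the critical case, where once more the
    second order term decides ([capture_weights], [blue_rare]). If it becomes
    negative, then, after a slight perturbation that creates a uniform slack,
    its part before the first change of sign gives finitely supported weights
    with positive drift, and blue survives with positive probability
    ([subsolution], [blue_likely]).

    So blue dies out exactly for the viable [rho]. The values of [shoot] are
    polynomials in [rho], so viability is a closed condition and holds at
    [rho_c]. At [rho = 0] the recurrence has constant coefficients and oscillates
    exactly when its discriminant [(1 + lambda) ^ 2 - 4 * d * lambda] is
    negative, that is, for [lambda] in the open interval of the theorem; there,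
    viability fails for all small [rho]. It holds as soon as
    [4 * d * lambda <= (1 + lambda + rho) * (1 + lambda + 2 * rho)]: for every
    [rho > 0] if [lambda] lies outside of the interval, and always for
    [rho = 3 / 4 * rho_e], which separates [rho_c] from [rho_e]. *)

(** * Discrete Markov chains with finite branching *)

Lemma ler_sum_seq (R : numDomainType) (I : eqType) (r : seq I) (P : pred I)
    (F G : I -> R) : (forall i, i \in r -> P i -> F i <= G i) ->
  \sum_(i <- r | P i) F i <= \sum_(i <- r | P i) G i.
Proof.
move=> H; rewrite big_seq_cond [leRHS]big_seq_cond.
by apply: ler_sum => i /andP[]; exact: H.
Qed.

Section JumpChain.
Context {R : realType} {S : countType}.
Variables (q : S -> S -> R) (succ : S -> seq S) (x0 : S).

Definition nexts x := if exit_rate q x == 0 then [:: x] else succ x.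

Fixpoint reach n y : Prop :=
  if n is m.+1 then exists2 x, reach m x & y \in nexts x else y = x0.

(** The conditions are only required of the states that can be reached, because
    the rates out of an inconsistent configuration may be unlisted. *)
Definition finite_branching := forall n x, reach n x ->
  [/\ uniq (succ x), (forall y, 0 <= q x y) &
      (forall y, y \notin succ x -> q x y = 0)].

Definition step (phi : S -> R) x := \sum_(y <- nexts x) jump_prob q x y * phi y.

Definition mean n phi := iter n step phi x0.

Hypothesis fb : finite_branching.

Lemma exit_rateE n x : reach n x -> exit_rate q x = \sum_(y <- succ x) q x y.
Proof.
move=> /fb[us q0 qs]; rewrite /exit_rate.
have -> : (\esum_(y in [set: S]) (q x y)%:E =
           \esum_(y in [set` succ x]) (q x y)%:E)%E.
  rewrite [RHS]esum_mkcond; apply: eq_esum => y _.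
  case: ifPn => // /negP yx; rewrite qs //; apply/negP => yx'; apply: yx.
  by rewrite inE.
rewrite esum_fset; last 2 first.
- exact: finite_seq.
- by move=> y _; rewrite lee_fin.
by rewrite -fsbig_seq //= sumEFin.
Qed.

Lemma uniq_nexts n x : reach n x -> uniq (nexts x).
Proof. by rewrite /nexts; case: ifP => // _ /fb[]. Qed.

Lemma jump_prob_ge0 n x y : reach n x -> 0 <= jump_prob q x y.
Proof.
move=> rx; rewrite /jump_prob; case: ifP => // _.
have [us q0 qs] := fb rx; rewrite divr_ge0 // (exit_rateE rx).
exact: sumr_ge0.
Qed.

Lemma sum_jump_prob n x : reach n x -> \sum_(y <- nexts x) jump_prob q x y = 1.
Proof.
move=> rx; rewrite /nexts /jump_prob; case: ifPn => [_|e0].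
  by rewrite big_seq1 eqxx.
by rewrite -mulr_suml -(exit_rateE rx) divff.
Qed.

Lemma jump_prob_out n x y : reach n x -> y \notin nexts x -> jump_prob q x y = 0.
Proof.
move=> rx; rewrite /nexts /jump_prob; case: ifPn => [_|e0 yx].
  by rewrite inE eq_sym => /negbTE ->.
by have [_ _ ->//] := fb rx; rewrite mul0r.
Qed.

Lemma iter_step_le n m x phi psi : reach m x ->
  (forall y, reach (m + n) y -> phi y <= psi y) ->
  iter n step phi x <= iter n step psi x.
Proof.
elim: n m x => [|n IH] m x rx H; first by apply: H; rewrite addn0.
rewrite !iterS; apply: ler_sum_seq => y yx _.
rewrite ler_wpM2l ?(jump_prob_ge0 _ rx) //; apply: (IH m.+1); first by exists x.
by rewrite addSnnS.
Qed.

Lemma mean_le n phi psi : (forall y, reach n y -> phi y <= psi y) ->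
  mean n phi <= mean n psi.
Proof. by move=> H; apply: (@iter_step_le n 0). Qed.

Lemma eq_mean n phi psi : (forall y, reach n y -> phi y = psi y) ->
  mean n phi = mean n psi.
Proof.
by move=> H; apply/eqP; rewrite eq_le !mean_le // => y /H ->.
Qed.

Lemma step_affine n x a b phi : reach n x ->
  step (fun y => a * phi y + b) x = a * step phi x + b.
Proof.
move=> rx; rewrite /step; under eq_bigr do rewrite mulrDr.
rewrite big_split /= -mulr_suml (sum_jump_prob rx) mul1r mulr_sumr; congr (_ + _).
by apply: eq_bigr => y _; rewrite mulrCA.
Qed.

Lemma stepD x phi psi :
  step (fun y => phi y + psi y) x = step phi x + step psi x.
Proof. by rewrite -big_split; apply: eq_bigr => y _; rewrite mulrDr. Qed.

Lemma stepS_le n x phi c : reach n x -> (forall y, y \in nexts x -> phi y <= c) ->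
  step phi x <= c.
Proof.
move=> rx H; rewrite -[leRHS]mul1r -(sum_jump_prob rx) mulr_suml.
by apply: ler_sum_seq => y yx _; rewrite ler_wpM2l ?(jump_prob_ge0 _ rx) ?H.
Qed.

Lemma step_lt n x y phi c : reach n x -> (forall z, z \in nexts x -> phi z <= c) ->
  y \in nexts x -> 0 < jump_prob q x y -> phi y < c -> step phi x < c.
Proof.
move=> rx H yx py lty; rewrite -[ltRHS]mul1r -(sum_jump_prob rx) mulr_suml.
rewrite /step !(perm_big _ (perm_to_rem yx)) /= !big_cons.
rewrite ltr_leD ?ltr_pM2l //.
apply: ler_sum_seq => z zx _; rewrite ler_wpM2l ?(jump_prob_ge0 _ rx) //.
by apply: H; apply: mem_rem zx.
Qed.

Lemma meanD n phi psi :
  mean n (fun y => phi y + psi y) = mean n phi + mean n psi.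
Proof.
rewrite /mean; elim: n phi psi => // n IH phi psi.
by rewrite !iterSr -IH; congr (iter _ _ _ _); apply/funext => x; rewrite stepD.
Qed.

Lemma mean_affine n a b phi : mean n (fun y => a * phi y + b) = a * mean n phi + b.
Proof.
elim: n phi => // n IH phi; rewrite /mean !iterSr -[in RHS]/(mean _ _) -IH.
by apply: eq_mean => x rx; rewrite (step_affine _ _ _ rx).
Qed.

Lemma mean_cst n c : mean n (fun=> c) = c.
Proof.
rewrite -[RHS]add0r -[X in _ = X + _](mul0r (mean n (fun=> 0))) -mean_affine.
by apply: eq_mean => y _; rewrite mul0r add0r.
Qed.

Lemma meanS n phi : mean n.+1 phi = mean n (step phi).
Proof. by rewrite /mean iterSr. Qed.

Lemma mean_decr phi : (forall n x, reach n x -> step phi x <= phi x) ->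
  forall n m, (n <= m)%N -> mean m phi <= mean n phi.
Proof.
move=> H n m; elim: m => [|m IH]; first by rewrite leqn0 => /eqP ->.
rewrite leq_eqVlt ltnS => /predU1P[-> //|/IH]; apply: le_trans.
by rewrite meanS; apply: mean_le => y /H.
Qed.

Lemma mean_incr phi : (forall n x, reach n x -> phi x <= step phi x) ->
  forall n, phi x0 <= mean n phi.
Proof.
move=> H; elim=> [//|n IH]; apply: le_trans IH _.
by rewrite meanS; apply: mean_le => y /H.
Qed.

(** Otherwise the mean of [M], which stays below [K], would grow at least like
    a multiple of the harmonic series. *)
Lemma transience (M : S -> R) (A : pred S) (K kappa eta : R) n0 :
  0 < kappa -> 0 < eta -> (forall x, 0 <= M x <= K) ->
  (forall n x, reach n x -> M x + kappa / n.+1%:R * (A x)%:R <= step M x) ->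
  exists2 n, (n0 <= n)%N & mean n (fun x => (A x)%:R) < eta.
Proof.
move=> k0 e0 MK H; apply: contrapT => N.
have mM n : 0 <= mean n M <= K.
  rewrite -[X in X <= _ <= _](mean_cst n) -[X in _ <= _ <= X](mean_cst n).
  by apply/andP; split; apply: mean_le => y _; have /andP[] := MK y.
pose c0 := \sum_(i < n0) (kappa * eta / i.+1%:R).
have s0 n : 0 <= \sum_(i < n) (kappa * eta / i.+1%:R).
  by apply: sumr_ge0 => i _; rewrite divr_ge0 // mulr_ge0 // ltW.
have grow n : \sum_(i < n) (kappa * eta / i.+1%:R) <= mean n M + c0.
  elim: n => [|n IH].
    by rewrite big_ord0 addr_ge0 ?s0 //; have /andP[] := mM 0%N.
  have [n0n|nn0] := leqP n0 n; last first.
    apply: (@le_trans _ _ c0); last by rewrite lerDr; have /andP[] := mM n.+1.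
    rewrite /c0 -(subnKC nn0) big_split_ord /= lerDl.
    by apply: sumr_ge0 => i _; rewrite divr_ge0 // mulr_ge0 // ltW.
  rewrite big_ord_recr /= meanS.
  have /mean_le : forall y, reach n y ->
     M y + (kappa / n.+1%:R * (A y)%:R + 0) <= step M y.
    by move=> y /H; rewrite addr0.
  rewrite meanD mean_affine addr0 -(lerD2r c0); apply: le_trans.
  rewrite addrAC lerD // mulrAC ler_pM2l ?divr_gt0 //.
  by rewrite leNgt; apply/negP => h; apply: N; exists n.
have HK n : \sum_(i < n) (kappa * eta / i.+1%:R) <= K + c0.
  by apply: le_trans (grow n) _; rewrite lerD2r; have /andP[] := mM n.
have := @dvg_harmonic R; apply.
apply: nondecreasing_is_cvgn.
  by apply: nondecreasing_series => n _ _; rewrite /harmonic /=.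
exists ((K + c0) / (kappa * eta)) => _ [n _ <-].
rewrite ler_pdivlMr ?mulr_gt0 // mulrC; apply: le_trans (HK n).
rewrite seriesEord /= mulr_sumr; apply: ler_sum => i _.
by rewrite /harmonic /= mulrC.
Qed.

End JumpChain.

(** * From the continuous-time chain to its jump chain *)

Section Law.
Local Open Scope classical_set_scope.
Context {R : realType} {S : countType}.
Variables (q : S -> S -> R) (succ : S -> seq S) (x0 : S).
Hypothesis fb : finite_branching q succ x0.
Context {disp : measure_display} {Omega : measurableType disp}.
Variables (P : probability Omega R) (X : R -> Omega -> S).
Variables (Y : nat -> Omega -> S) (H : nat -> Omega -> \bar R).
Hypothesis mY : forall n x, measurable [set w | Y n w = x].
Hypothesis mH : forall n, measurable_fun [set: Omega] (H n).
Hypothesis H_gt0 : forall n w, (0 < H n w)%E.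
Hypothesis pathX : forall w t, 0 <= t -> exists n,
  [/\ (\sum_(i < n) H i w <= t%:E)%E,
      (t%:E < \sum_(i < n.+1) H i w)%E & X t w = Y n w].
Hypothesis law : forall (n : nat) (y : nat -> S) (t : nat -> R),
  (forall i, 0 <= t i) ->
  P [set w | (forall i, (i <= n)%N -> Y i w = y i) /\
             (forall i, (i < n)%N -> ((t i)%:E < H i w)%E)] =
  ((y 0%N == x0)%:R *
   \prod_(i < n) (jump_prob q (y i) (y i.+1) *
                  expR (- (exit_rate q (y i) * t i))))%:E.

Let p := jump_prob q.
Local Notation next := (nexts q succ).
Local Notation reachable := (reach q succ x0).

Let cyl n (y : nat -> S) := [set w | forall i, (i <= n)%N -> Y i w = y i].
Let weight n (y : nat -> S) : R :=
  (y 0%N == x0)%:R * \prod_(i < n) p (y i) (y i.+1).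

Let P_cyl n y : P (cyl n y) = (weight n y)%:E.
Proof.
transitivity (P [set w | (forall i, (i <= n)%N -> Y i w = y i) /\
             (forall i, (i < n)%N -> ((0 : R)%:E < H i w)%E)]).
  by congr (P _); apply/seteqP; split=> w //= [].
rewrite (@law _ _ (fun=> 0)) //; congr (_ * _)%:E.
by apply: eq_bigr => i _; rewrite mulr0 oppr0 expR0 mulr1.
Qed.

Lemma measurable_chain n (T : pred S) : measurable [set w | T (Y n w)].
Proof.
have -> : [set w | T (Y n w)] =
    \bigcup_(x : S) (if T x then [set w | Y n w = x] else set0).
  apply/seteqP; split=> w /= => [Tw|[x _]]; first by exists (Y n w); rewrite ?Tw.
  by case: ifP => //= Tx ->.
apply: countable_bigcupT_measurable; first exact: countableP.
by move=> x; case: ifP.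
Qed.

Let measurable_cyl n y : measurable (cyl n y).
Proof.
have -> : cyl n y = \bigcap_i (if (i <= n)%N then [set w | Y i w = y i] else setT).
  apply/seteqP; split=> [w h i _|w h i le_in]; first by case: ifP => // /h.
  by have := h i I; rewrite le_in.
by apply: bigcapT_measurable => i; case: ifP.
Qed.

Let weightS n y : weight n.+1 y = weight n y * p (y n) (y n.+1).
Proof. by rewrite /weight big_ord_recr /= mulrA. Qed.

Let weight_reach n y : weight n y != 0 -> reachable n (y n).
Proof.
elim: n => [|n IH].
  by rewrite /weight big_ord0 mulr1; case: (y 0%N =P x0) => //; rewrite eqxx.
rewrite weightS mulf_eq0 negb_or => /andP[/IH rn pn]; exists (y n) => //.
by apply: contraNT pn => yx; rewrite /p (jump_prob_out fb rn yx).
Qed.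

Let extend n (y : nat -> S) z := fun i => if (i <= n)%N then y i else z.

Let weight_extend n y z : weight n.+1 (extend n y z) = weight n y * p (y n) z.
Proof.
rewrite weightS /extend leqnn ltnn; congr (_ * _).
rewrite /weight /=; congr (_ * _); apply: eq_bigr => i _.
by rewrite ltnW // (ltn_ord i).
Qed.

Let cyl_extend n y z : cyl n.+1 (extend n y z) = cyl n y `&` [set w | Y n.+1 w = z].
Proof.
apply/seteqP; split=> w /= => [h|[h1 h2] i].
  split; last by rewrite h // /extend ltnn.
  by move=> i le_in; rewrite h ?(leq_trans le_in) // /extend le_in.
rewrite leq_eqVlt ltnS /extend => /predU1P[->|le_in]; first by rewrite ltnn.
by rewrite le_in h1.
Qed.

Let P_split n (l : seq S) A : measurable A -> uniq l ->
  (P A = \sum_(z <- l) P (A `&` [set w | Y n w = z]) +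
         P (A `&` [set w | Y n w \notin l]))%E.
Proof.
move=> mA; elim: l => [_|z l IH /= /andP[zl ul]].
  by rewrite big_nil add0e; congr (P _); apply/seteqP; split=> w //= [].
rewrite big_cons -addeA addeCA IH //; congr (_ + _)%E.
rewrite -measureU; first last.
- apply/seteqP; split=> w //= [[_ ->] [_]]; by rewrite inE eqxx.
- by apply: measurableI => //; apply: (measurable_chain n (fun x => x \notin _)).
- exact: measurableI.
congr (P _); apply/seteqP; split=> w /=.
  move=> [Aw wl]; have [->|nz] := eqVneq (Y n w) z; [by left|right].
  by rewrite inE negb_or nz.
by move=> [[Aw ->]|[Aw]] //; rewrite inE negb_or => /andP[].
Qed.

Let P_cyl_chain k m y (T : pred S) :
  P (cyl m y `&` [set w | T (Y (m + k)%N w)]) =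
  (weight m y * iter k (step q succ) (fun x => (T x)%:R) (y m))%:E.
Proof.
have [y0|yn0] := eqVneq (weight m y) 0.
  rewrite y0 mul0r; apply/eqP; rewrite -measure_le0.
  have <- : P (cyl m y) = 0%E by rewrite P_cyl y0.
  apply: le_measure; rewrite ?inE //.
  by apply: measurableI => //; exact: measurable_chain.
elim: k m y yn0 => [|k IH] m y yn0.
  rewrite /= addn0; case: (boolP (T (y m))) => Ty.
    rewrite mulr1 -P_cyl; congr (P _); apply/seteqP; split=> w /= => [[]//|h].
    by split=> //; rewrite h.
  rewrite mulr0 -[RHS](measure0 P); congr (P _); apply/seteqP; split=> w //= [h].
  by rewrite h // (negbTE Ty).
have rm := weight_reach yn0.
rewrite (@P_split m.+1 (next (y m))) ?(uniq_nexts fb rm) //; last first.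
  by apply: measurableI => //; exact: measurable_chain.
rewrite [X in (_ + X)%E](_ : _ = 0%E); last first.
  have := @P_split m.+1 (next (y m)) _ (measurable_cyl m y) (uniq_nexts fb rm).
  under eq_bigr do rewrite -cyl_extend P_cyl weight_extend.
  rewrite sumEFin -mulr_sumr (sum_jump_prob fb rm) mulr1 P_cyl.
  set B := _ `&` _ => PB.
  have mB : measurable B.
    by apply: measurableI => //; apply: (measurable_chain m.+1 (fun x => x \notin _)).
  have PB0 : P B = 0%E.
    move: PB; rewrite -(fineK (fin_num_measure P _ mB)) -EFinD => -[].
    by move=> /eqP; rewrite -subr_eq0 opprD addNKr oppr_eq0 => /eqP ->.
  apply/eqP; rewrite -measure_le0 -PB0; apply: le_measure; rewrite ?inE //.
    apply: measurableI; last exact: (measurable_chain m.+1 (fun x => x \notin _)).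
    by apply: measurableI => //; exact: measurable_chain.
  by move=> w [[? ?] ?].
rewrite adde0 iterS /step mulr_sumr -sumEFin; apply: eq_big_seq => z zm.
rewrite mulrA -[X in (X * _)%:E](weight_extend m y z) setIAC -cyl_extend addnS -addSn.
have [z0|zn0] := eqVneq (weight m.+1 (extend m y z)) 0.
  rewrite z0 mul0r; apply/eqP; rewrite -measure_le0.
  have <- : P (cyl m.+1 (extend m y z)) = 0%E by rewrite P_cyl z0.
  apply: le_measure; rewrite ?inE //.
  by apply: measurableI => //; exact: measurable_chain.
have ez : extend m y z m.+1 = z by rewrite /extend ltnn.
by rewrite (IH _ _ zn0) ez.
Qed.


(** The transition operator only sums over listed successors; the remaining
    paths form a null event because the listed ones already have total mass
    one. *)
Lemma prob_chain n (T : pred S) :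
  P [set w | T (Y n w)] = (mean q succ x0 n (fun x => (T x)%:R))%:E.
Proof.
have w0 : weight 0 (fun=> x0) = 1 by rewrite /weight eqxx big_ord0 mulr1.
have m0 := measurable_cyl 0 (fun=> x0).
have mT := measurable_chain n T.
have := @P_cyl_chain n 0 (fun=> x0) T; rewrite w0 mul1r add0n /mean => <-.
apply/eqP; rewrite eq_le; apply/andP; split; last first.
  by apply: le_measure; rewrite ?inE //; exact: measurableI.
have c0 : P (~` cyl 0 (fun=> x0)) = 0%E.
  by rewrite probability_setC // P_cyl w0 subee.
rewrite -[leRHS]adde0 -c0.
apply: le_trans (measureU2 _ _ _); rewrite ?inE //; last 2 first.
- exact: measurableI.
- exact: measurableC.
apply: le_measure; rewrite ?inE //.
  by apply: measurableU; [exact: measurableI|exact: measurableC].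
by move=> w Tw; have [c|c] := pselect (cyl 0 (fun=> x0) w); [left|right].
Qed.

(* Exceeding every level [t] has probability at most [exp (- e * t)] for some
   [e > 0]. *)
Let holding_finite n y : weight n.+1 y != 0 -> exit_rate q (y n) != 0 ->
  P (cyl n.+1 y `&` [set w | H n w = +oo%E]) = 0%E.
Proof.
move=> wn0 en0; have rn : reachable n (y n).
  by apply: weight_reach; apply: contra wn0; rewrite weightS => /eqP ->; rewrite mul0r.
have e0 : 0 < exit_rate q (y n).
  rewrite lt_neqAle eq_sym en0 (exit_rateE fb rn); have [_ q0 _] := fb rn.
  exact: sumr_ge0.
have mG : measurable (cyl n.+1 y `&` [set w | H n w = +oo%E]).
  apply: measurableI => //; rewrite -[X in measurable X]setTI.
  exact: (mH n measurableT (emeasurable_set1 +oo%E)).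
have H1 t : 0 <= t -> (P (cyl n.+1 y `&` [set w | H n w = +oo%E]) <=
    (weight n.+1 y * expR (- (exit_rate q (y n) * t)))%:E)%E.
  move=> t0; pose tt i := if i == n then t else 0.
  have tt0 i : 0 <= tt i by rewrite /tt; case: ifP.
  have -> : weight n.+1 y * expR (- (exit_rate q (y n) * t)) =
    (y 0%N == x0)%:R *
   \prod_(i < n.+1) (jump_prob q (y i) (y i.+1) *
                  expR (- (exit_rate q (y i) * tt i))).
    rewrite big_split /= mulrA; congr (_ * _); rewrite big_ord_recr /= /tt eqxx.
    rewrite big1 ?mul1r // => i _; rewrite ltn_eqF ?ltn_ord //.
    by rewrite mulr0 oppr0 expR0.
  rewrite -(@law n.+1 y tt) //; apply: le_measure; rewrite ?inE //.
    have -> : [set w | (forall i, (i <= n.+1)%N -> Y i w = y i) /\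
      (forall i, (i < n.+1)%N -> ((tt i)%:E < H i w)%E)] =
      cyl n.+1 y `&` [set w | (t%:E < H n w)%E].
      apply/seteqP; split=> w /= [h1 h2]; split=> //.
        by have := h2 n (ltnSn n); rewrite /tt eqxx.
      by move=> i _; rewrite /tt; case: eqP => [->|].
    apply: measurableI => //; rewrite -[X in measurable X]setTI.
    exact: emeasurable_fun_o_infty.
  move=> w /= [h1 h2]; split=> // i.
  by rewrite /tt; case: eqP => [->|]; rewrite ?h2 ?ltry.
move: H1; rewrite -(fineK (fin_num_measure P _ mG)).
set g := fine _ => H1; have : 0 <= g by apply: fine_ge0.
rewrite le_eqVlt => /predU1P[<- //|g0].
set c := weight _ _ in H1.
have c0 : 0 < c.
  have := H1 0 (lexx 0); rewrite mulr0 oppr0 expR0 mulr1 lee_fin.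
  exact: lt_le_trans.
(* The level at which the exponential bound falls below [g]. *)
have := H1 (c / (g * exit_rate q (y n))).
rewrite lee_fin => h; have {h} := h (divr_ge0 (ltW c0) (mulr_ge0 (ltW g0) (ltW e0))).
have -> : exit_rate q (y n) * (c / (g * exit_rate q (y n))) = c / g.
  by field; rewrite en0 gt_eqF.
rewrite expRN => h; exfalso; move: h; apply/negP; rewrite -ltNge.
have h1 := expR_ge1Dx (c / g).
have h2 : 0 < 1 + c / g by rewrite addr_gt0 // divr_gt0.
apply: (@le_lt_trans _ _ (c / (1 + c / g))).
  by rewrite ler_pM2l // lef_pV2 // posrE expR_gt0.
rewrite ltr_pdivrMr // mulrDr mulr1 mulrCA divff ?gt_eqF // mulr1.
by rewrite ltrDr.
Qed.

(** Almost surely every jump leads to a listed successor, and only absorbing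
    states are held forever. *)
Lemma ae_path : {ae P, forall w, Y 0%N w = x0 /\
  forall n, Y n.+1 w \in next (Y n w) /\
    (H n w = +oo%E -> exit_rate q (Y n w) = 0)}.
Proof.
(* Countably many finite paths suffice to witness a failure. *)
pose F (sn : seq S * nat) := let y := nth x0 sn.1 in let n := sn.2 in
  [set w | cyl n.+1 y w /\ (weight n.+1 y = 0 \/
     [/\ weight n.+1 y != 0, exit_rate q (y n) != 0 & H n w = +oo%E])].
have F0 sn : P.-negligible (F sn).
  case: sn => s n; rewrite /F /=; set y := nth _ _.
  have [w0|w0] := eqVneq (weight n.+1 y) 0.
    exists (cyl n.+1 y); split; [exact: measurable_cyl| |by move=> w []].
    by rewrite P_cyl w0.
  have [e0|e0] := eqVneq (exit_rate q (y n)) 0.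
    by exists set0; split=> // w [_ [h|[_ //]]]; rewrite h eqxx in w0.
  exists (cyl n.+1 y `&` [set w | H n w = +oo%E]); split.
  - apply: measurableI => //; rewrite -[X in measurable X]setTI.
    exact: (mH n measurableT (emeasurable_set1 +oo%E)).
  - exact: holding_finite.
  - by move=> w [? [h|[]]]; rewrite ?h ?eqxx in w0 *.
have : P.-negligible (\bigcup_k (if choice.unpickle k is Some sn then F sn else set0)).
  apply: negligible_bigcup => k; case: choice.unpickle => [sn|]; first exact: F0.
  exact: negligible_set0.
apply: negligibleS => w /= Hw; apply: contrapT => nF.
have good n : weight n.+1 (fun i => Y i w) != 0 /\
    (exit_rate q (Y n w) = 0 \/ H n w != +oo%E).
  pose s := mkseq (fun i => Y i w) n.+2.
  have sE i : (i <= n.+1)%N -> nth x0 s i = Y i w by move=> h; rewrite nth_mkseq.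
  have wE : weight n.+1 (nth x0 s) = weight n.+1 (fun i => Y i w).
    rewrite /weight sE //; congr (_ * _); apply: eq_bigr => i _.
    by rewrite !sE // ltnW.
  have nFs : ~ F (s, n) w.
    by move=> h; apply: nF; exists (choice.pickle (s, n)) => //; rewrite choice.pickleK.
  have cs : cyl n.+1 (nth x0 s) w by move=> i /sE ->.
  have w0 : weight n.+1 (fun i => Y i w) != 0.
    by apply/eqP => w0; apply: nFs; split=> //; left; rewrite wE.
  split=> //; have [e0|e0] := eqVneq (exit_rate q (Y n w)) 0; [by left|right].
  by apply/eqP => h; apply: nFs; split=> //; right; rewrite wE sE //.
apply: Hw; split.
  by have := weight_reach (good 0%N).1; have [+ _] := good 0%N; rewrite /weight;
    case: (Y 0%N w =P x0) => // _; rewrite mul0r eqxx.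
move=> n; have [g1 g2] := good n; split.
  have rn : reachable n (Y n w).
    apply: (@weight_reach n (fun i => Y i w)).
    by apply: contra g1; rewrite weightS => /eqP ->; rewrite mul0r.
  apply: contraNT g1 => yx; rewrite weightS /p (jump_prob_out fb rn yx).
  by rewrite mulr0.
by move=> h; case: g2 => //; rewrite h eqxx.
Qed.

Let T n w := (\sum_(i < n) H i w)%E.

Let T_ge0 n w : (0 <= T n w)%E.
Proof. by apply: sume_ge0 => i _; apply: ltW. Qed.

Let T_le n m w : (n <= m)%N -> (T n w <= T m w)%E.
Proof.
elim: m => [|m IH]; first by rewrite leqn0 => /eqP ->.
rewrite leq_eqVlt ltnS => /predU1P[-> //|/IH]; move/le_trans; apply.
by rewrite /T big_ord_recr /= leeDl // ltW.
Qed.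

(** A state of the jump chain is only visited if it is entered in finite time;
    being exact, this description makes the event measurable, even when the
    underlying measure is not complete. *)
Lemma visitsE (D : pred S) w : (exists2 t : R, 0 <= t & D (X t w)) <->
  (exists n, (T n w < +oo)%E /\ D (Y n w)).
Proof.
split=> [[t t0 Dt]|[n [Tn Dn]]].
  have [n [h1 h2 h3]] := pathX w t0; exists n; rewrite -h3; split=> //.
  by apply: le_lt_trans h1 _; exact: ltry.
have Tf : T n w \is a fin_num by rewrite ge0_fin_numE.
exists (fine (T n w)); first by rewrite fine_ge0.
have [|m [h1 h2 ->]] := @pathX w (fine (T n w)); first by rewrite fine_ge0.
rewrite fineK // in h1 h2; suff -> : m = n by [].
apply/eqP; rewrite eqn_leq; apply/andP; split; rewrite leqNgt; apply/negP => mn.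
  have := le_trans (T_le w mn) h1; apply/negP; rewrite -ltNge.
  by rewrite /T big_ord_recr /= lteDl.
by have := lt_le_trans h2 (T_le w mn); rewrite ltxx.
Qed.

Lemma measurable_visits (D : pred S) :
  measurable [set w | exists2 t : R, 0 <= t & D (X t w)].
Proof.
have -> : [set w | exists2 t : R, 0 <= t & D (X t w)] =
    \bigcup_n ([set w | (T n w < +oo)%E] `&` [set w | D (Y n w)]).
  apply/seteqP; split=> w /=.
    by rewrite visitsE => -[n [? ?]]; exists n.
  by move=> [n _ [? ?]]; rewrite visitsE; exists n.
apply: bigcupT_measurable => n; apply: measurableI; last exact: measurable_chain.
rewrite -[X in measurable X]setTI.
have mT : measurable_fun [set: Omega] (T n) by apply: emeasurable_sum => i.
exact: emeasurable_fun_infty_o.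
Qed.

(** A jump that never takes place leaves an absorbing state, so that it would
    not lead to a new state anyway. *)
Lemma ae_visits : {ae P, forall w, forall D : pred S,
  (exists2 t : R, 0 <= t & D (X t w)) <-> (exists n, D (Y n w))}.
Proof.
apply: filterS ae_path => w [Y0 HY] D; rewrite visitsE.
split=> [[n [_ Dn]]|[n Dn]]; first by exists n.
suff [Tn|[m [Tm Ym _]]] : (T n w < +oo)%E \/ exists m,
    [/\ (T m w < +oo)%E, Y m w = Y n w & exit_rate q (Y m w) = 0].
- by exists n.
- by exists m; rewrite Ym.
elim: n {Dn} => [|n [Tn|[m [Tm Ym em]]]].
- by left; rewrite /T big_ord0 ltry.
- have [Hn|Hn] := eqVneq (H n w) +oo%E; last first.
    left; rewrite /T big_ord_recr /= lte_add_pinfty //.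
    by rewrite ltey.
  have [Yn /(_ Hn) en] := HY n; right; exists n; split=> //.
  by move: Yn; rewrite /next /nexts en eqxx inE => /eqP.
- right; exists m; split=> //; have [+ _] := HY n.
  by rewrite -Ym /next /nexts em eqxx inE => /eqP.
Qed.


Let ae_le (N A B : set Omega) : measurable N -> P N = 0%E ->
  measurable A -> measurable B -> A `<=` B `|` N -> (P A <= P B)%E.
Proof.
move=> mN N0 mA mB AB; rewrite -[leRHS]adde0 -N0.
apply: le_trans (measureU2 _ _ _); rewrite ?inE //.
by apply: le_measure; rewrite ?inE //; exact: measurableU.
Qed.

Lemma ae_skeleton : {ae P, forall w, exists Z : nat -> S,
  [/\ Z = Y ^~ w, Z 0%N = x0, (forall n, Z n.+1 \in next (Z n)) &
      forall D : pred S,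
        (exists2 t : R, 0 <= t & D (X t w)) <-> (exists n, D (Z n))]}.
Proof.
apply: filterS2 ae_path ae_visits => w [Y0 HY] HD; exists (Y ^~ w); split=> // n.
by have [] := HY n.
Qed.

(** The event [E] says that the nondecreasing count [M] is unbounded along the
    jump chain. It is only compared with this description on paths that follow
    listed successors, which almost all paths do. *)
Section Unbounded.
Variables (E : set Omega) (M : S -> nat).
Hypothesis mE : measurable E.
Hypothesis ME : forall w (Z : nat -> S), Z 0%N = x0 ->
  (forall n, Z n.+1 \in next (Z n)) ->
  (forall D : pred S,
     (exists2 t : R, 0 <= t & D (X t w)) <-> (exists n, D (Z n))) ->
  E w <-> (forall K, exists n, (K <= M (Z n))%N).
Hypothesis Mincr : forall n x y, reachable n x -> y \in next x -> (M x <= M y)%N.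

Let F K n := [set w | exists2 m, (m <= n)%N & (K <= M (Y m w))%N].

Let mF K n : measurable (F K n).
Proof.
have -> : F K n = \bigcup_(m in [set m | (m <= n)%N]) [set w | (K <= M (Y m w))%N].
  by apply/seteqP; split=> w /= [m mn Km]; exists m.
apply: bigcup_measurable => m _.
exact: (measurable_chain m (fun x => (K <= M x)%N)).
Qed.

Let mU K : measurable (\bigcup_n F K n).
Proof. by apply: bigcupT_measurable. Qed.

Let F_cvg K : P \o F K @ \oo --> P (\bigcup_n F K n).
Proof.
apply: nondecreasing_cvg_mu => //; apply/nondecreasing_seqP => n.
by apply/subsetPset => w [m mn Km]; exists m => //; exact: leqW.
Qed.

Let skel : exists N, [/\ measurable N, P N = 0%E & forall w, ~ N w ->
  exists Z : nat -> S, [/\ Z = Y ^~ w, Z 0%N = x0,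
   (forall n, Z n.+1 \in next (Z n)) & forall D : pred S,
        (exists2 t : R, 0 <= t & D (X t w)) <-> (exists n, D (Z n))]].
Proof.
have [N [mN N0 hN]] := ae_skeleton; exists N; split=> // w nN.
by apply: contrapT => h; apply/nN/hN.
Qed.

Lemma prob_unbounded_le (delta : R) :
  (forall eps, 0 < eps -> exists K, forall n,
     mean q succ x0 n (fun x => (K <= M x)%N%:R) <= delta + eps) ->
  (P E <= delta%:E)%E.
Proof.
move=> Hd; apply/lee_addgt0Pr => eps eps0; have [K HK] := Hd _ eps0.
have [N [mN N0 hN]] := skel.
apply: (@le_trans _ _ (P (\bigcup_n F K n))).
  apply: (ae_le mN N0) => // w Ew; have [Nw|/hN[Z [-> Y0 HY HD]]] := pselect (N w).
    by right.
  have /(ME Y0 HY HD)/(_ K)[n Kn] := Ew.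
  by left; exists n => //; exists n.
rewrite -(cvg_lim _ (F_cvg (K := K))) //; apply: lime_le.
  by apply/cvg_ex; eexists; exact: F_cvg.
apply: nearW => n /=; apply: (@le_trans _ _ (P [set w | (K <= M (Y n w))%N])).
  apply: (ae_le mN N0) => //; first exact: (measurable_chain n (fun x => (K <= M x)%N)).
  move=> w [m mn Km]; have [Nw|/hN[Z [ZE Y0 HY _]]] := pselect (N w).
    by right.
  left => /=; apply: leq_trans Km _; rewrite ZE in Y0 HY.
  have rY k : reachable k (Y k w) by elim: k => [//|k IH]; exists (Y k w).
  elim: n mn => [|n IH]; first by rewrite leqn0 => /eqP ->.
  rewrite leq_eqVlt ltnS => /predU1P[-> //|/IH] h.
  exact: leq_trans h (Mincr (rY n) (HY n)).
by rewrite (prob_chain n (fun x => (K <= M x)%N)) -EFinD lee_fin.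
Qed.

Lemma prob_unbounded_ge (delta : R) :
  (forall K eps, 0 < eps -> exists n,
     delta - eps <= mean q succ x0 n (fun x => (K <= M x)%N%:R)) ->
  (delta%:E <= P E)%E.
Proof.
move=> Hd; have [N [mN N0 hN]] := skel.
have mUU : measurable (\bigcap_K \bigcup_n F K n) by exact: bigcapT_measurable.
apply: (@le_trans _ _ (P (\bigcap_K \bigcup_n F K n))); last first.
  apply: (ae_le mN N0) => // w Fw; have [Nw|/hN[Z [ZE Y0 HY HD]]] := pselect (N w).
    by right.
  left; apply/(ME Y0 HY HD) => K; have [n _ [m _ Km]] := Fw K I.
  by exists m; rewrite ZE.
have cvgU : P \o (fun K => \bigcup_n F K n) @ \oo --> P (\bigcap_K \bigcup_n F K n).
  apply: nonincreasing_cvg_mu => //.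
  - by rewrite (le_lt_trans (probability_le1 _ _)) // ltry.
  - apply/nonincreasing_seqP => K; apply/subsetPset => w [n _ [m mn Km]].
    by exists n => //; exists m => //; exact: ltnW.
rewrite -(cvg_lim _ cvgU) //; apply: lime_ge.
  by apply/cvg_ex; eexists; exact: cvgU.
apply: nearW => K /=; apply/lee_addgt0Pr => eps eps0; have [n Hn] := Hd K _ eps0.
rewrite -leeBlDr //; apply: (@le_trans _ _ (P [set w | (K <= M (Y n w))%N])).
  by rewrite (prob_chain n (fun x => (K <= M x)%N)) -EFinB lee_fin.
apply: le_measure; rewrite ?inE //.
  exact: (measurable_chain n (fun x => (K <= M x)%N)).
by move=> w Kw; exists n => //; exists n.
Qed.

End Unbounded.

End Law.

(** * Transitions of chase-escape with death on the tree *)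

Section Tree.
Context {R : realType} {d : nat}.
Variables lambda rho : R.
Hypothesis lambda_gt0 : 0 < lambda.
Hypothesis rho_gt0 : 0 < rho.
Local Notation word := (seq 'I_d).
Local Notation conf := (config (tvertex d)).
Implicit Types (c : conf) (u v : word) (s : vstate).

Definition par u : tvertex d := if u is _ :: v then Some v else None.
Definition flip c u s : conf := [fsfun c with Some u |-> s]%fsfun.
Definition words c : seq word := pmap id (finsupp c).

(** Whatever is not white was infected by its parent, and whatever is blue was
    captured from its parent; hence the edges that carry a transition all point
    away from the root. *)
Definition tree_inv c :=
  [/\ c None = Blue, c (Some [::]) != White,
      (forall i u, c (Some (i :: u)) != White -> c (Some u) != White) &
      (forall i u, c (Some (i :: u)) = Blue -> c (Some u) = Blue)].

Lemma flipE c u s v : flip c u s (Some v) = if v == u then s else c (Some v).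
Proof. by rewrite /flip fsfun_withE. Qed.

Lemma flip_None c u s : flip c u s None = c None.
Proof. by rewrite /flip fsfun_withE. Qed.

Lemma flip_same c u s : flip c u s (Some u) = s.
Proof. by rewrite flipE eqxx. Qed.

Lemma mem_words c u : (u \in words c) = (c (Some u) != White).
Proof.
by rewrite /words mem_pmap map_id mem_finsupp.
Qed.

Lemma words_uniq c : uniq (words c).
Proof.
apply: (@pmap_uniq _ _ id Some); last exact: fset_uniq.
by case=> // u.
Qed.

Lemma words_flip c u s : s != White -> c (Some u) != White ->
  perm_eq (words (flip c u s)) (words c).
Proof.
move=> s0 u0; apply: uniq_perm; rewrite ?words_uniq // => v.
by rewrite !mem_words flipE; case: (v =P u) => // ->; rewrite s0 u0.
Qed.

Lemma words_infect c u s : s != White -> c (Some u) = White ->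
  perm_eq (words (flip c u s)) (u :: words c).
Proof.
move=> s0 u0; apply: uniq_perm; rewrite /= ?words_uniq ?mem_words ?u0 // => v.
by rewrite inE !mem_words flipE; case: (v =P u).
Qed.

Definition reds c := [seq u <- words c | c (Some u) == Red].
Definition frontier c :=
  [seq i :: u | u <- reds c, i <- [seq i <- enum 'I_d | c (Some (i :: u)) == White]].
Definition moves c : seq (word * vstate) :=
  [seq (x, Red) | x <- frontier c] ++
  [seq (u, Blue) | u <- [seq u <- reds c | c (par u) == Blue]] ++
  [seq (u, Dead) | u <- reds c].
Definition succ c := [seq flip c m.1 m.2 | m <- moves c].

(** The transitions are grouped by the red vertex that infects, is captured or
    dies, so that this sum can be exchanged with sums over vertices. *)
Definition rate_sum c (f : word -> vstate -> R) :=
  \sum_(u <- words c | c (Some u) == Red)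
    (lambda * (\sum_(i | c (Some (i :: u)) == White) f (i :: u) Red) +
     (c (par u) == Blue)%:R * f u Blue + rho * f u Dead).

Lemma mem_reds c u : (u \in reds c) = (c (Some u) == Red).
Proof. by rewrite mem_filter mem_words; case: (c (Some u)). Qed.

Lemma mem_frontier c x : reflect
  (exists i u, [/\ x = i :: u, c (Some u) = Red & c (Some x) = White])
  (x \in frontier c).
Proof.
apply: (iffP allpairsPdep) => [[u [i [ru iu ->]]]|[i [u [-> ru iu]]]].
  exists i, u; move: ru iu; rewrite mem_reds mem_filter => /eqP -> /andP[/eqP -> _].
  by [].
by exists u, i; rewrite mem_reds mem_filter ru iu mem_enum.
Qed.

Lemma mem_moves c m : m \in moves c ->
  [\/ [/\ m.2 = Red, c (Some m.1) = White &
         exists i u, m.1 = i :: u /\ c (Some u) = Red],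
      [/\ m.2 = Blue, c (Some m.1) = Red & c (par m.1) = Blue] |
      m.2 = Dead /\ c (Some m.1) = Red].
Proof.
rewrite !mem_cat => /or3P[] /mapP[u + ->] /=.
- by move=> /mem_frontier[i [v [-> rv iv]]]; constructor 1; split=> //; exists i, v.
- by rewrite mem_filter mem_reds => /andP[/eqP ? /eqP ?]; constructor 2.
- by rewrite mem_reds => /eqP ?; constructor 3.
Qed.

Lemma moves_uniq c : uniq (moves c).
Proof.
have ur : uniq (reds c) by rewrite filter_uniq // words_uniq.
have um (s : vstate) (l : seq word) : uniq l -> uniq [seq (u, s) | u <- l].
  by move=> ul; rewrite map_inj_uniq // => u v [].
have uf : uniq (frontier c).
  apply: allpairs_uniq_dep => //.
    by move=> u _; rewrite filter_uniq // enum_uniq.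
  by move=> [u i] [v j] _ _ /= [-> ->].
rewrite /moves !cat_uniq !um ?filter_uniq ?words_uniq //= andbT; apply/andP; split.
  rewrite has_cat; apply/norP; split; apply/hasPn => m /mapP[u _ ->];
  by apply/negP => /mapP[].
by apply/hasPn => m /mapP[u _ ->]; apply/negP => /mapP[].
Qed.

Lemma moves_change c m : m \in moves c -> m.2 != White /\ c (Some m.1) != m.2.
Proof. by move=> /mem_moves[[-> ->]|[-> ->]|[-> ->]]. Qed.

Lemma succ_uniq c : uniq (succ c).
Proof.
rewrite map_inj_in_uniq ?moves_uniq // => -[u s] [v t] /moves_change /= [_ cs] _.
move=> e; have := congr1 (fun c' : conf => c' (Some u)) e; rewrite flip_same flipE.
case: eqP => [-> ->|_ sc] //; by rewrite sc eqxx in cs.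
Qed.

(** The children of [u] cannot be responsible for a flip of [u], so the parent
    alone is counted. *)
Lemma nb_countE c u s : s != White -> (forall i, c (Some (i :: u)) != s) ->
  nb_count (@tadj d) c (Some u) s = (c (par u) == s).
Proof.
move=> s0 us; rewrite /nb_count.
have [e|ne] := eqVneq (c (par u)) s.
  rewrite [X in #|` X|](_ : _ = [fset par u]%fset) ?cardfs1 //.
  apply/fsetP => x; rewrite !inE mem_finsupp; apply/idP/eqP.
    move=> /andP[_ /andP[+ /eqP xs]]; case: x xs => [w|] xs; rewrite /tadj /=.
      case: u us {e} => [|i u] us /=.
        by case: w xs => // j w xs /eqP ?; subst w; have := us j; rewrite xs eqxx.
      move=> /orP[/eqP -> //|]; case: w xs => // j w xs /eqP ?; subst w.
      by have := us j; rewrite xs eqxx.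
    by case: u us {e}.
  move=> ->; rewrite e s0 eqxx andbT /= /tadj; case: u {us e} => //= i u.
  by rewrite eqxx.
rewrite [X in #|` X|](_ : _ = fset0%fset) ?cardfs0 //.
apply/fsetP => x; rewrite !inE mem_finsupp; apply/negP.
move=> /andP[_ /andP[+ /eqP xs]]; case: x xs => [w|] xs; rewrite /tadj /=.
  case: u us ne => [|i u] us ne /=.
    by case: w xs => // j w xs /eqP ?; subst w; have := us j; rewrite xs eqxx.
  move=> /orP[/eqP ?|]; first by subst w; rewrite /= xs eqxx in ne.
  case: w xs => // j w xs /eqP ?; subst w.
  by have := us j; rewrite xs eqxx.
by case: u us ne => //= us; rewrite xs eqxx.
Qed.

Definition move_rate c (m : word * vstate) : R :=
  flip_rate (@tadj d) lambda rho c (Some m.1) m.2.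

Lemma ced_rate_flip c u s : s != White -> c (Some u) != s ->
  ced_rate (@tadj d) lambda rho c (flip c u s) = move_rate c (u, s).
Proof.
move=> s0 us; rewrite /ced_rate /move_rate /=.
have uf : Some u \in finsupp (flip c u s) by rewrite mem_finsupp flip_same.
rewrite (perm_big _ (perm_to_rem uf)) /= big_cons flip_same eqxx.
rewrite big1_seq ?addr0 // => x /andP[/eqP e xr].
exfalso; have xu : x != Some u.
  by move: xr; rewrite mem_rem_uniq ?fset_uniq // inE => /andP[].
have := congr1 (fun c' : conf => c' (Some u)) e.
rewrite flip_same fsfun_withE eq_sym (negbTE xu) => sc.
by rewrite -sc eqxx in us.
Qed.

Definition kind_rate s : R := if s is Red then lambda else if s is Blue then 1 else rho.

Lemma rate_sum_moves c f :
  \sum_(m <- moves c) kind_rate m.2 * f m.1 m.2 = rate_sum c f.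
Proof.
rewrite !big_cat /= !big_map /rate_sum /frontier big_allpairs_dep /reds !big_filter /=.
rewrite big_filter_cond [in X in _ + (X + _)]big_mkcondr /= -!big_split /=.
apply: eq_bigr => u ru; rewrite big_filter big_enum_cond /= mulr_sumr addrA.
by congr (_ + _ + _); case: ifP => _; rewrite ?mul1r ?mul0r.
Qed.

Section Inv.
Variable c : conf.
Hypothesis ci : tree_inv c.

Lemma white_child u i : c (Some u) = White -> c (Some (i :: u)) = White.
Proof.
have [_ _ h _] := ci; move=> uw; apply/eqP; apply: contraT => /h.
by rewrite uw eqxx.
Qed.

Lemma move_rateE m : m \in moves c ->
  move_rate c m = kind_rate m.2.
Proof.
have [_ _ h1 h2] := ci; rewrite /move_rate /flip_rate.
move=> /mem_moves[[-> uw [i [u [ue ru]]]]|[-> ur pb]|[-> ->]] //.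
  rewrite uw nb_countE // ?ue /= ?ru ?mulr1 // => j.
  by rewrite -ue (white_child _ uw).
rewrite ur nb_countE // ?pb // => j; apply/eqP => /h2.
by rewrite ur.
Qed.

Lemma flip_rate_gt0 u s : flip_rate (@tadj d) lambda rho c (Some u) s != 0 ->
  (u, s) \in moves c.
Proof.
have [_ hr h1 h2] := ci; rewrite /flip_rate !mem_cat.
case cu: (c (Some u)); case: s; rewrite ?eqxx //.
- rewrite nb_countE //; last by move=> j; rewrite (white_child _ cu).
  case: (c (par u) =P Red) => [|_]; last by rewrite mulr0 eqxx.
  case: u cu => [|i u] cu /= pu _; first by rewrite cu eqxx in hr.
  by apply/orP; left; apply/map_f/mem_frontier; exists i, u.
- rewrite nb_countE //; last by move=> j; apply/eqP => /h2; rewrite cu.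
  case: (c (par u) =P Blue) => [pu _|_]; last by rewrite eqxx.
  by apply/or3P; constructor 2; apply: map_f; rewrite mem_filter mem_reds cu pu.
- by move=> _; apply/or3P; constructor 3; apply: map_f; rewrite mem_reds cu.
Qed.

Lemma flip_rate_ge0 (v : tvertex d) s : 0 <= flip_rate (@tadj d) lambda rho c v s.
Proof.
rewrite /flip_rate; case: (c v); case: s => //; rewrite ?ler0n // ?(ltW rho_gt0) //.
by rewrite mulr_ge0 ?ler0n // ltW.
Qed.

Lemma ced_rate_ge0 c' : 0 <= ced_rate (@tadj d) lambda rho c c'.
Proof. by apply: sumr_ge0 => v _; exact: flip_rate_ge0. Qed.

Lemma ced_rate_out c' : c' \notin succ c ->
  ced_rate (@tadj d) lambda rho c c' = 0.
Proof.
have [c0 _ _ _] := ci.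
move=> nc; rewrite /ced_rate big1 // => -[u|] /eqP e.
  apply/eqP; apply: contraNT nc => /flip_rate_gt0 mu.
  by rewrite e; apply/mapP; exists (u, c' (Some u)).
by rewrite /flip_rate c0.
Qed.

Lemma sum_succ (f : conf -> R) :
  \sum_(y <- succ c) ced_rate (@tadj d) lambda rho c y * f y =
  rate_sum c (fun u s => f (flip c u s)).
Proof.
rewrite big_map -(rate_sum_moves c (fun u s => f (flip c u s))).
apply: eq_big_seq => -[u s] mm; have [s0 us] := moves_change mm.
by rewrite ced_rate_flip // move_rateE.
Qed.

End Inv.


Let q := ced_rate (@tadj d) lambda rho.
Let reachable := reach q succ (tree_init d).

Lemma tree_initE u : tree_init d (Some u) = if u == [::] then Red else White.
Proof. by rewrite /tree_init !fsfun_withE fsfun0E /=; case: u. Qed.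

Lemma tree_init_None : tree_init d None = Blue.
Proof. by rewrite /tree_init !fsfun_withE. Qed.

Lemma words_init : words (tree_init d) = [:: [::]].
Proof.
apply: perm_small_eq => //; apply: uniq_perm; rewrite ?words_uniq // => u.
by rewrite mem_words tree_initE inE; case: (u =P [::]).
Qed.

Lemma tree_inv_init : tree_inv (tree_init d).
Proof.
split; rewrite ?tree_init_None //; first by rewrite tree_initE.
  by move=> i u; rewrite !tree_initE.
by move=> i u; rewrite !tree_initE.
Qed.

Lemma tree_inv_move c m : tree_inv c -> m \in moves c -> tree_inv (flip c m.1 m.2).
Proof.
case: m => u s [c0 cr cw cb] /[dup] /moves_change /= [s0 us] mm.
split; rewrite ?flip_None //.
- by rewrite flipE; case: ([::] =P u).
- move=> i v; rewrite !flipE; case: (v =P u) => // vu.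
  case: (i :: v =P u) => [e|ne]; last exact: cw.
  move: mm => /mem_moves /= [[_ uw [j [w []]]]|[_ ur _]|[_ ur]].
  + by rewrite -e => -[_ <-] ->.
  + by move=> _; apply: (cw i); rewrite e ur.
  + by move=> _; apply: (cw i); rewrite e ur.
- move=> i v; rewrite !flipE; case: (i :: v =P u) => [e|ne].
    move=> sb; move: mm => /mem_moves /= []; rewrite sb; [by case| |by case].
    move=> [_ ur]; rewrite -e /= => pb; rewrite pb; by case: ifP.
  move=> /(cb i v) ub; case: (v =P u) => [vu|//]; rewrite vu in ub.
  by move: mm => /mem_moves /= [[_]|[_]|[_]]; rewrite ub.
Qed.

Lemma mem_nexts c y : y \in nexts q succ c ->
  y = c \/ exists2 m, m \in moves c & y = flip c m.1 m.2.
Proof.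
rewrite /nexts; case: ifP => _; first by rewrite inE => /eqP; left.
by move=> /mapP[m mm ->]; right; exists m.
Qed.

Lemma reach_inv n c : reachable n c -> tree_inv c.
Proof.
elim: n c => [c ->|n IH c [b /IH bi /mem_nexts[->//|[m mm ->]]]].
  exact: tree_inv_init.
exact: tree_inv_move.
Qed.

Lemma ced_finite_branching : finite_branching q succ (tree_init d).
Proof.
move=> n c /reach_inv ci; split; first exact: succ_uniq.
  exact: ced_rate_ge0.
exact: ced_rate_out.
Qed.

Let fb := ced_finite_branching.

Definition blues c := count (fun u => c (Some u) == Blue) (words c).

Lemma size_words_move c m : m \in moves c ->
  (size (words c) <= size (words (flip c m.1 m.2)) <= (size (words c)).+1)%N.
Proof.
move=> mm; have [s0 us] := moves_change mm.
have [uw|un] := eqVneq (c (Some m.1)) White.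
  by rewrite (perm_size (words_infect s0 uw)) /= leqnSn leqnn.
by rewrite (perm_size (words_flip s0 un)) leqnn leqnSn.
Qed.

Lemma blues_flip c u s : s != White -> c (Some u) != Blue ->
  blues (flip c u s) = ((s == Blue) + blues c)%N.
Proof.
move=> s0 ub.
have aux r : u \notin r -> count (fun v => flip c u s (Some v) == Blue) r =
    count (fun v => c (Some v) == Blue) r.
  move=> ur; apply: eq_in_count => v vr; rewrite flipE.
  by case: (v =P u) => // e; rewrite -e vr in ur.
rewrite /blues; have [uw|un] := eqVneq (c (Some u)) White.
  have /permP -> := words_infect s0 uw; rewrite /= flip_same aux //.
  by rewrite mem_words uw.
have /permP -> := words_flip s0 un.
have uc : u \in words c by rewrite mem_words.
have /permP uP := perm_to_rem uc; rewrite !uP /= flip_same (negbTE ub) add0n aux //.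
by rewrite mem_rem_uniq ?words_uniq // inE eqxx.
Qed.

Lemma size_words_reach n c : reachable n c -> (size (words c) <= n.+1)%N.
Proof.
elim: n c => [c ->|n IH c [b /IH bi /mem_nexts[->|[m mm ->]]]].
- by rewrite words_init.
- exact: leqW.
- by have /andP[_ h] := size_words_move mm; rewrite (leq_trans h).
Qed.

Lemma size_words_incr n c y : reachable n c -> y \in nexts q succ c ->
  (size (words c) <= size (words y))%N.
Proof.
by move=> _ /mem_nexts[->//|[m mm ->]]; have /andP[] := size_words_move mm.
Qed.

Lemma blues_incr n c y : reachable n c -> y \in nexts q succ c ->
  (blues c <= blues y)%N.
Proof.
move=> _ /mem_nexts[->//|[m mm ->]]; have [s0 us] := moves_change mm.
rewrite blues_flip ?leq_addl //.
by move: mm => /mem_moves[[_ ->]|[_ ->]|[_ ->]].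
Qed.

Lemma rate_sum_le c f g :
  (forall i u, c (Some u) = Red -> c (Some (i :: u)) = White ->
     f (i :: u) Red <= g (i :: u) Red) ->
  (forall u, c (Some u) = Red -> c (par u) = Blue -> f u Blue <= g u Blue) ->
  (forall u, c (Some u) = Red -> f u Dead <= g u Dead) ->
  rate_sum c f <= rate_sum c g.
Proof.
move=> h1 h2 h3; apply: ler_sum => u /eqP ur; rewrite lerD //; last first.
  by rewrite ler_pM2l // h3.
rewrite lerD //; last by case: eqP => [pb|_]; rewrite ?mul1r ?mul0r // h2.
by rewrite ler_pM2l //; apply: ler_sum => i /eqP iw; apply: h1.
Qed.

Lemma kind_rate_gt0 s : 0 < kind_rate s.
Proof. by case: s. Qed.

Lemma rate_sum_ge_move c f m : m \in moves c ->
  (forall m', m' \in moves c -> 0 <= f m'.1 m'.2) ->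
  kind_rate m.2 * f m.1 m.2 <= rate_sum c f.
Proof.
move=> mm f0; rewrite -rate_sum_moves (perm_big _ (perm_to_rem mm)) big_cons lerDl.
rewrite big_seq; apply: sumr_ge0 => m' /mem_rem mm'.
by rewrite mulr_ge0 ?(ltW (kind_rate_gt0 _)) ?f0.
Qed.

Lemma eq_rate_sum c f g : (forall m, m \in moves c -> f m.1 m.2 = g m.1 m.2) ->
  rate_sum c f = rate_sum c g.
Proof.
move=> h; apply/eqP; rewrite eq_le; apply/andP; split; apply: rate_sum_le.
all: move=> *; rewrite le_eqVlt; apply/orP; left; apply/eqP.
all: first [apply: (h (_, _)) | apply/esym; apply: (h (_, _))].
all: rewrite !mem_cat.
all: apply/or3P.
1,4: by constructor 1; apply/map_f/mem_frontier; do 2 eexists.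
1,3: by constructor 2; apply/map_f; rewrite mem_filter mem_reds;
  apply/andP; split; apply/eqP.
all: by constructor 3; apply/map_f; rewrite mem_reds; apply/eqP.
Qed.

Lemma rate_sumD c f g :
  rate_sum c (fun u s => f u s + g u s) = rate_sum c f + rate_sum c g.
Proof.
rewrite -big_split; apply: eq_bigr => u _ /=; rewrite big_split /=; ring.
Qed.

Lemma rate_sumZ c a f : rate_sum c (fun u s => a * f u s) = a * rate_sum c f.
Proof.
rewrite mulr_sumr; apply: eq_bigr => u _ /=; rewrite -mulr_sumr; ring.
Qed.

Lemma rate_sumB c f g :
  rate_sum c (fun u s => f u s - g u s) = rate_sum c f - rate_sum c g.
Proof.
rewrite rate_sumD; congr (_ + _).
rewrite -[RHS]mulN1r -rate_sumZ; apply: eq_rate_sum => m _.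
by rewrite mulN1r.
Qed.

Lemma rate_sum_ge0 c f : (forall u s, 0 <= f u s) -> 0 <= rate_sum c f.
Proof.
move=> f0; apply: sumr_ge0 => u _.
rewrite !addr_ge0 ?mulr_ge0 ?f0 ?ler0n ?(ltW lambda_gt0) ?(ltW rho_gt0) //.
by apply: sumr_ge0 => i _; exact: f0.
Qed.

(** The generator of the process. Its sign at [phi] is the sign of the mean
    increment of [phi] in one jump, whatever the total rate. *)
Definition gen (phi : conf -> R) c :=
  rate_sum c (fun u s => phi (flip c u s) - phi c).
Definition total_rate c := rate_sum c (fun _ _ => 1).

Lemma total_rate_ge c u : c (Some u) = Red -> rho <= total_rate c.
Proof.
move=> ur; have uc : u \in words c by rewrite mem_words ur.
rewrite /total_rate /rate_sum (perm_big _ (perm_to_rem uc)) /= big_cons ur eqxx.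
rewrite -[leLHS]addr0 lerD //; last first.
  apply: sumr_ge0 => v _; rewrite !addr_ge0 ?mulr_ge0 ?(ltW lambda_gt0) ?(ltW rho_gt0) //.
  exact: sumr_ge0.
rewrite !mulr1 lerDr addr_ge0 ?mulr_ge0 ?(ltW lambda_gt0) //.
exact: sumr_ge0.
Qed.

Lemma total_rate_ge0 c : 0 <= total_rate c.
Proof. exact: rate_sum_ge0. Qed.

Lemma rate_sum_eq0 c f : total_rate c = 0 -> rate_sum c f = 0.
Proof.
move=> e0; rewrite /rate_sum big1 // => u /eqP /total_rate_ge.
by rewrite e0 leNgt rho_gt0.
Qed.

(** Each jump adds at most one vertex, so the jump rate grows at most linearly;
    this is what makes the harmonic series of [transience] appear. *)
Lemma total_rate_le n c : reachable n c ->
  total_rate c <= (lambda * d%:R + 1 + rho) * n.+1%:R.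
Proof.
move=> rc; set C := _ + rho.
have C0 : 0 <= C.
  by rewrite /C !addr_ge0 ?mulr_ge0 ?ler0n ?(ltW lambda_gt0) ?(ltW rho_gt0).
apply: (@le_trans _ _ (\sum_(u <- words c) C)); last first.
  rewrite big_const_seq count_predT iter_addr_0 -[C *+ _]mulr_natr.
  by rewrite ler_wpM2l // ler_nat (size_words_reach rc).
rewrite /total_rate /rate_sum [leLHS]big_mkcond; apply: ler_sum => u _.
case: ifP => // _; rewrite /C !mulr1 lerD // lerD //; last by case: eqP.
rewrite ler_pM2l // sumr_const ler_nat.
by apply: leq_trans (max_card _) _; rewrite card_ord.
Qed.

Lemma exit_rate_total n c : reachable n c -> exit_rate q c = total_rate c.
Proof.
move=> rc; rewrite (exit_rateE fb rc) /total_rate.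
have <- := sum_succ (reach_inv rc) (fun=> 1).
by apply: eq_bigr => y _; rewrite mulr1.
Qed.

Lemma step_gen n c phi : reachable n c ->
  step q succ phi c = phi c + gen phi c / total_rate c.
Proof.
move=> rc; rewrite /step /nexts (exit_rate_total rc) /jump_prob.
rewrite (exit_rate_total rc).
have [e0|e0] := eqVneq (total_rate c) 0.
  by rewrite big_seq1 eqxx mul1r e0 invr0 mulr0 addr0.
under eq_bigr do rewrite mulrAC.
rewrite -mulr_suml (sum_succ (reach_inv rc)) /gen rate_sumB.
rewrite mulrBl addrC.
have -> : rate_sum c (fun _ _ => phi c) = phi c * total_rate c.
  by rewrite -rate_sumZ; apply: eq_rate_sum => m _; rewrite mulr1.
by rewrite mulfK // subrK.
Qed.

Lemma gen_ge0_step n c phi : reachable n c -> 0 <= gen phi c ->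
  phi c <= step q succ phi c.
Proof.
by move=> rc g0; rewrite (step_gen _ rc) lerDl divr_ge0 // total_rate_ge0.
Qed.

Lemma gen_le0_step n c phi : reachable n c -> gen phi c <= 0 ->
  step q succ phi c <= phi c.
Proof.
move=> rc g0; rewrite (step_gen _ rc) gerDl mulr_le0_ge0 // invr_ge0.
exact: total_rate_ge0.
Qed.

Lemma gen_step_lb n c phi kappa (A : bool) : reachable n c -> 0 <= kappa ->
  kappa * A%:R <= gen phi c ->
  phi c + kappa / (lambda * d%:R + 1 + rho) / n.+1%:R * A%:R <= step q succ phi c.
Proof.
move=> rc k0 kA; rewrite (step_gen _ rc) lerD2l.
set C := _ + rho.
have C0 : 0 < C.
  by rewrite ltr_wpDl // addr_ge0 // mulr_ge0 ?ler0n // ltW.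
have -> : kappa / C / n.+1%:R * A%:R = kappa * A%:R * (C * n.+1%:R)^-1.
  by rewrite invfM; ring.
have [e0|e0] := eqVneq (total_rate c) 0.
  move: kA; rewrite /gen (rate_sum_eq0 _ e0) mul0r => kA.
  by rewrite mulr_le0_ge0 // invr_ge0 mulr_ge0 // ltW.
have E0 : 0 < total_rate c by rewrite lt_neqAle eq_sym e0 total_rate_ge0.
apply: (@le_trans _ _ (kappa * A%:R / total_rate c)); last first.
  by rewrite ler_pM2r ?invr_gt0.
rewrite ler_wpM2l ?mulr_ge0 //.
by rewrite lef_pV2 ?posrE ?mulr_gt0 // total_rate_le.
Qed.

Lemma gen_ge_move c (phi : conf -> R) m : m \in moves c ->
  (forall m', m' \in moves c -> phi c <= phi (flip c m'.1 m'.2)) ->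
  kind_rate m.2 * (phi (flip c m.1 m.2) - phi c) <= gen phi c.
Proof.
move=> mm h.
apply: (@rate_sum_ge_move c (fun u s => phi (flip c u s) - phi c)) => // m' /h.
by rewrite subr_ge0.
Qed.

Lemma gen_ge0 c (phi : conf -> R) :
  (forall m, m \in moves c -> phi c <= phi (flip c m.1 m.2)) -> 0 <= gen phi c.
Proof.
move=> h; rewrite /gen -rate_sum_moves big_seq; apply: sumr_ge0 => m /h mm.
by rewrite mulr_ge0 ?subr_ge0 // ltW // kind_rate_gt0.
Qed.

Lemma total_rate_gt0 c m : m \in moves c -> 0 < total_rate c.
Proof.
move=> mm; have := @rate_sum_ge_move c (fun _ _ => 1) m mm (fun _ _ => ler01).
by rewrite mulr1; apply: lt_le_trans; exact: kind_rate_gt0.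
Qed.

Lemma move_nexts n c m : reachable n c -> m \in moves c ->
  flip c m.1 m.2 \in nexts q succ c.
Proof.
move=> rc mm; rewrite /nexts (exit_rate_total rc) gt_eqF ?(total_rate_gt0 mm) //.
by apply/mapP; exists m.
Qed.

Lemma move_prob_gt0 n c m : reachable n c -> m \in moves c ->
  0 < jump_prob q c (flip c m.1 m.2).
Proof.
move=> rc mm; have ci := reach_inv rc; have e0 := total_rate_gt0 mm.
have [s0 us] := moves_change mm; case: m mm s0 us => u s mm /= s0 us.
rewrite /jump_prob (exit_rate_total rc) gt_eqF // divr_gt0 //.
by rewrite /q ced_rate_flip // move_rateE // kind_rate_gt0.
Qed.

Lemma step_move_lt n c (phi : conf -> R) m a : reachable n c -> m \in moves c ->
  (forall c', c' \in nexts q succ c -> phi c' <= a) ->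
  phi (flip c m.1 m.2) < a -> step q succ phi c < a.
Proof.
move=> rc mm phia; exact: (step_lt fb rc phia (move_nexts rc mm) (move_prob_gt0 rc mm)).
Qed.

End Tree.

(** * Weights for the chase along a ray *)

Section ExpBounds.
Context {R : realType}.
Implicit Types x : R.

Lemma expRN_ge1B x : 1 - expR (- x) <= x.
Proof. by have := expR_ge1Dx (- x); lra. Qed.

(** Square the bound [1 - x / 2 <= exp (- x / 2)]. *)
Lemma expRN_quad_ge x : 0 <= x <= 1 -> 1 - expR (- x) <= x - x ^+ 2 / 4.
Proof.
move=> x01; have -> : - x = - (x / 2) + - (x / 2) by lra.
rewrite expRD; have := expR_ge1Dx (- (x / 2)); set e := expR _ => he.
by nra.
Qed.

Lemma expRN_quad_le x : `|x| <= 1 / 4 -> expR (- x) <= 1 - x + x ^+ 2.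
Proof.
rewrite ler_norml => x14.
have h := expR_ge1Dx (x / 2).
have e0 : 0 < expR (x / 2) by exact: expR_gt0.
have -> : expR (- x) = (expR (x / 2) ^+ 2)^-1.
  by rewrite expRN expr2 -expRD; congr (expR _)^-1; lra.
rewrite -[leRHS]mulr1 -[leLHS]mul1r ler_pdivrMr ?exprn_gt0 // mulr1.
have h2 : (1 + x / 2) ^+ 2 <= expR (x / 2) ^+ 2.
  by rewrite ler_sqr ?nnegrE //; lra.
apply: (@le_trans _ _ ((1 - x + x ^+ 2) * (1 + x / 2) ^+ 2)); first by nra.
by rewrite ler_wpM2l //; nra.
Qed.

End ExpBounds.

Section Shooting.
Context {R : realType} {d : nat}.
Hypothesis d_gt0 : (0 < d)%N.
Variable lambda : R.
Hypothesis lambda_gt0 : 0 < lambda.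
Let ld := lambda * d%:R.
Let ld0 : 0 < ld. Proof. by rewrite mulr_gt0 // ltr0n. Qed.

(** Two consecutive values of the solution of the drift equation
    [(1 + lambda + j * rho) * w j + kappa = w (j - 1) + lambda * d * w (j + 1)]
    that starts with [0, 1]. The parameter [kappa] is the drift. *)
Fixpoint shoot2 (kappa rho : R) n : R * R :=
  if n is m.+1 then
    let p := shoot2 kappa rho m in
    (p.2, ((1 + lambda + m.+1%:R * rho) * p.2 - p.1 + kappa) / (lambda * d%:R))
  else (0, 1).
Definition shoot kappa rho n := (shoot2 kappa rho n).1.

Lemma shoot0 kappa rho : shoot kappa rho 0 = 0. Proof. by []. Qed.
Lemma shoot1 kappa rho : shoot kappa rho 1 = 1. Proof. by []. Qed.
Lemma shootE kappa rho n :
  (1 + lambda + n.+1%:R * rho) * shoot kappa rho n.+1 + kappa =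
  shoot kappa rho n + lambda * d%:R * shoot kappa rho n.+2.
Proof.
rewrite /shoot /=; set p := shoot2 _ _ _.
by rewrite mulrCA divff ?mulr1 ?gt_eqF //; lra.
Qed.

Lemma shoot_continuous n :
  (forall kappa, continuous (fun rho => shoot kappa rho n)) /\
  (forall rho, continuous (fun kappa => shoot kappa rho n)).
Proof.
suff : (forall kappa, continuous (fun rho => (shoot2 kappa rho n).1) /\
          continuous (fun rho => (shoot2 kappa rho n).2)) /\
       (forall rho, continuous (fun kappa => (shoot2 kappa rho n).1) /\
          continuous (fun kappa => (shoot2 kappa rho n).2)).
  by move=> [h1 h2]; split=> r; [have [] := h1 r|have [] := h2 r].
elim: n => [|n [IH1 IH2]]; first by split=> r; split=> x; exact: cvg_cst.
split=> r.
- have [h1 h2] := IH1 r; split => // x /=.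
  apply: cvgMl; apply: cvgD; last exact: cvg_cst.
  apply: cvgB; last exact: h1.
  apply: cvgM; last exact: h2.
  apply: cvgD; first exact: cvg_cst.
  by apply: cvgMr; exact: cvg_id.
- have [h1 h2] := IH2 r; split => // x /=.
  apply: cvgMl; apply: cvgD; last exact: cvg_id.
  apply: cvgB; last exact: h1.
  by apply: cvgMr; exact: h2.
Qed.

Lemma shoot_near_rho rho n : shoot 0 rho n < 0 ->
  exists2 delta, 0 < delta &
    forall rho', `|rho' - rho| < delta -> shoot 0 rho' n < 0.
Proof.
move=> h; have [/(_ 0 rho) c _] := shoot_continuous n.
have /nbhs_ballP[e /= e0 he] := c _ (lt_nbhsl h).
by exists e => // r hr; apply: he; rewrite /ball /= distrC.
Qed.

Lemma shoot_near_kappa rho n : shoot 0 rho n < 0 ->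
  exists2 kappa, 0 < kappa & shoot kappa rho n < 0.
Proof.
move=> h; have [_ /(_ rho 0) c] := shoot_continuous n.
have /nbhs_ballP[e /= e0 he] := c _ (lt_nbhsl h).
exists (e / 2); first by rewrite divr_gt0.
apply: he; rewrite /ball /= sub0r normrN gtr0_norm ?divr_gt0 //.
by rewrite gtr_pMr // invf_lt1 // ltr1n.
Qed.

Definition viable rho := forall n, 0 <= shoot 0 rho n.

(** A zero after a positive value forces the next value to be negative. *)
Lemma viable_gt0 rho : viable rho -> forall n, 0 < shoot 0 rho n.+1.
Proof.
move=> v; elim=> [|n IH]; first by rewrite shoot1.
rewrite lt_neqAle v andbT; apply/eqP => e.
have := shootE 0 rho n.+1; rewrite -e mulr0 add0r => /eqP.
by rewrite eq_sym gt_eqF // ltr_pwDl // mulr_ge0 // ltW.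
Qed.

(** Under this condition [2 * shoot n <= A (n + 1) * shoot (n + 1)] propagates,
    where [A n = 1 + lambda + n * rho]; the product [A n * A (n + 1)] is smallest
    for [n = 1]. *)
Lemma viable_sufficient rho : 0 <= rho ->
  4 * d%:R * lambda <= (1 + lambda + rho) * (1 + lambda + 2 * rho) -> viable rho.
Proof.
move=> r0 h; pose A n := 1 + lambda + n%:R * rho.
have A0 n : 0 < A n by rewrite /A ltr_wpDr ?mulr_ge0 // addr_gt0.
have AA n : 4 * ld <= A n.+1 * A n.+2.
  rewrite /ld (_ : 4 * _ = 4 * d%:R * lambda); last by ring.
  apply: le_trans h _; rewrite /A; apply: ler_pM.
  - by rewrite addr_ge0 // addr_ge0 // ltW.
  - by rewrite addr_ge0 ?mulr_ge0 // addr_ge0 // ltW.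
  - by rewrite lerD2l ler_peMl // ler1n.
  - by rewrite lerD2l ler_wpM2r // ler_nat.
suff H n : 0 <= shoot 0 rho n /\ 2 * shoot 0 rho n <= A n.+1 * shoot 0 rho n.+1.
  by move=> n; have [] := H n.
elim: n => [|n [IH1 IH2]].
  by rewrite shoot0 shoot1 mulr0 mulr1; split=> //; exact: ltW.
have q0 : 0 <= shoot 0 rho n.+1.
  rewrite -(pmulr_rge0 _ (A0 n.+1)); apply: le_trans IH2.
  by rewrite mulr_ge0.
split=> //; have := shootE 0 rho n; rewrite addr0 -/(A _) -/ld => e.
have h2 : A n.+1 * shoot 0 rho n.+1 <= 2 * ld * shoot 0 rho n.+2 by lra.
have := AA n; have := A0 n.+1; have := A0 n.+2.
move: (A n.+1) (A n.+2) (shoot 0 rho n.+1) (shoot 0 rho n.+2) h2 q0 ld0.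
move=> a b x y h2 x0 l0 b0 a0 ab.
rewrite -(ler_pM2l l0).
have : b * (a * x) <= b * (2 * ld * y) by rewrite ler_wpM2l // ltW.
have : 4 * ld * x <= a * b * x by rewrite ler_wpM2r.
nra.
Qed.

(** Otherwise the ratio of consecutive values stays positive. But since the
    characteristic polynomial [ld * t ^ 2 - (1 + lambda) * t + 1] has no real
    root, this ratio decreases by at least a fixed amount at each step. *)
Lemma not_viable0 : (1 + lambda) ^+ 2 < 4 * d%:R * lambda ->
  exists n, shoot 0 0 n < 0.
Proof.
move=> h; apply: contrapT => nh.
have v : viable 0 by move=> n; rewrite leNgt; apply/negP => hn; apply: nh; exists n.
have q0 := viable_gt0 v.
pose t n := shoot 0 0 n.+2 / shoot 0 0 n.+1.
have t0 n : 0 < t n by rewrite divr_gt0.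
have tE n : ld * t n.+1 = 1 + lambda - (t n)^-1.
  have := shootE 0 0 n.+1; rewrite mulr0 !addr0 -/ld => e.
  have e' : ld * shoot 0 0 n.+3 = (1 + lambda) * shoot 0 0 n.+2 - shoot 0 0 n.+1.
    by lra.
  move: (q0 n.+1) e'; rewrite /t.
  move: (shoot 0 0 n.+3) (shoot 0 0 n.+2) (shoot 0 0 n.+1) => x y z y0 e'.
  by rewrite invf_div mulrA e' mulrBl mulfK ?gt_eqF.
pose c := (4 * ld - (1 + lambda) ^+ 2) / (4 * ld ^+ 2).
have c0 : 0 < c.
  rewrite /c divr_gt0 //; last by rewrite mulr_gt0 // exprn_gt0.
  by rewrite subr_gt0 /ld (_ : 4 * _ = 4 * d%:R * lambda) //; ring.
have dec n : t n.+1 <= t n - c / t n.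
  rewrite -(ler_pM2l ld0) tE.
  have -> : ld * (t n - c / t n) =
     (ld * t n ^+ 2 - (4 * ld - (1 + lambda) ^+ 2) / (4 * ld)) / t n.
    by rewrite /c; field; rewrite !gt_eqF.
  have -> : 1 + lambda - (t n)^-1 = ((1 + lambda) * t n - 1) / t n.
    by field; rewrite gt_eqF.
  rewrite ler_pM2r ?invr_gt0 // -subr_ge0.
  have -> : ld * t n ^+ 2 - (4 * ld - (1 + lambda) ^+ 2) / (4 * ld) -
      ((1 + lambda) * t n - 1) = (2 * ld * t n - (1 + lambda)) ^+ 2 / (4 * ld).
    by field; rewrite gt_eqF.
  by rewrite divr_ge0 ?sqr_ge0 // mulr_ge0 // ltW.
have tle n : t n <= t 0%N.
  elim: n => // n IH; apply: le_trans (dec n) _; apply: le_trans IH.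
  by rewrite gerBl divr_ge0 // ltW.
have tn n : t n <= t 0%N - n%:R * (c / t 0%N).
  elim: n => [|n IH]; first by rewrite mul0r subr0.
  apply: le_trans (dec n) _; rewrite -natr1 mulrDl mul1r opprD addrA.
  apply: lerB => //; rewrite ler_pM2l // lef_pV2 ?posrE; [exact: tle|exact: t0|exact: t0].
have D0 : 0 < c / t 0%N by exact: divr_gt0.
have x0 : 0 <= t 0%N / (c / t 0%N) by apply: divr_ge0; exact: ltW.
have := tn (Num.bound (t 0%N / (c / t 0%N))); apply/negP; rewrite -ltNge.
apply: le_lt_trans (t0 _); rewrite subr_le0 -(ler_pdivrMr _ _ D0).
by rewrite ltW // archi_boundP.
Qed.


(** The slack [kappa] is created by solving the recurrence with a small positive
    drift, which still makes the solution negative at [m]. Cutting the solution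
    at its first nonpositive value only increases the right-hand side. *)
Lemma subsolution rho m : 0 <= rho -> shoot 0 rho m < 0 ->
  exists (w : nat -> R) (J : nat) (kappa : R),
  0 < kappa /\ [/\ w 0%N = 0, 0 < w 1%N, (forall j, 0 <= w j),
      (forall j, (J <= j)%N -> w j = 0) &
      forall j, (j < J)%N ->
        (1 + lambda + j.+1%:R * rho) * w j.+1 + kappa <=
          w j + lambda * d%:R * w j.+2].
Proof.
move=> rho0 /shoot_near_kappa[k k0 hm].
have exJ : exists n, (0 < n)%N && (shoot k rho n <= 0).
  exists m; rewrite (ltW hm) andbT lt0n; apply/eqP => m0.
  by move: hm; rewrite m0 shoot0 ltxx.
case: (ex_minnP exJ) => J /andP[J0 hJ] Jmin.
have pos j : (0 < j)%N -> (j < J)%N -> 0 < shoot k rho j.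
  move=> j0 jJ; rewrite ltNge; apply/negP => h.
  by have := Jmin j; rewrite j0 h => /(_ isT); rewrite leqNgt jJ.
have J2 : (1 < J)%N.
  case: J J0 hJ {Jmin pos} => [//|[|//]] _; rewrite shoot1 leNgt ltr01.
  by [].
pose w j := if (j < J)%N then shoot k rho j else 0.
exists w, J, (Num.min k (w J.-1)); split.
  by rewrite lt_min k0 /= /w ltn_predL J0 pos ?ltn_predL // -subn1 subn_gt0.
split.
- by rewrite /w J0.
- by rewrite /w J2 shoot1.
- move=> [|j]; rewrite /w; first by rewrite J0.
  by case: ifP => // jJ; rewrite ltW // pos.
- by move=> j; rewrite /w leqNgt => /negbTE ->.
move=> j jJ; have e := shootE k rho j.
have wE i : (i < J)%N -> w i = shoot k rho i by rewrite /w => ->.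
have wz i : (J <= i)%N -> w i = 0 by rewrite /w leqNgt => /negbTE ->.
have [jJ1|] := ltnP j.+1 J.
  apply: (@le_trans _ _ ((1 + lambda + j.+1%:R * rho) * shoot k rho j.+1 + k)).
    by rewrite wE // lerD2l ge_min lexx.
  rewrite e wE // lerD2l ler_wpM2l ?(ltW ld0) //.
  have [/wE -> //|Jj] := ltnP j.+2 J.
  rewrite wz //; have -> // : j.+2 = J.
  by apply/eqP; rewrite eqn_leq jJ1 Jj.
rewrite leq_eqVlt ltnS => /predU1P[jE|]; last by rewrite leqNgt jJ.
have w1 : w j.+1 = 0 by rewrite wz // jE.
have w2 : w j.+2 = 0 by rewrite wz // jE.
have jp : J.-1 = j by rewrite jE.
by rewrite w1 w2 jp !mulr0 add0r addr0 ge_min lexx orbT.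
Qed.

(** The minimum of two supersolutions is one again. A constant is a
    supersolution as soon as [j * rho >= lambda * d], and below that range the
    cap [K] is not active. *)
Lemma bounded_supersolution rho : 0 < rho -> viable rho ->
  exists w : nat -> R,
  [/\ w 0%N = 0, w 1%N = 1, (forall j, 0 < w j.+1), (exists K, forall j, w j <= K) &
      forall j, w j + lambda * d%:R * w j.+2 <=
                (1 + lambda + j.+1%:R * rho) * w j.+1].
Proof.
move=> r0 v; pose J := Num.bound (lambda * d%:R / rho).
have hJ j : (J <= j)%N -> lambda * d%:R <= j%:R * rho.
  move=> Jj; rewrite -ler_pdivrMr //.
  apply: (@le_trans _ _ J%:R); last by rewrite ler_nat.
  by rewrite ltW // archi_boundP // divr_ge0 ?ltW.
pose K := 1 + \sum_(i < J.+1) shoot 0 rho i.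
have K1 : 1 <= K by rewrite lerDl sumr_ge0.
have hK j : (j <= J)%N -> shoot 0 rho j <= K.
  move=> jJ; rewrite /K (bigD1 (Ordinal (jJ : (j < J.+1)%N))) //= addrCA lerDl.
  by rewrite addr_ge0 // sumr_ge0.
exists (fun j => Num.min (shoot 0 rho j) K); split.
- by apply/min_idPl; rewrite shoot0 (le_trans _ K1).
- exact/min_idPl.
- by move=> j; rewrite lt_min viable_gt0 // (lt_le_trans _ K1).
- by exists K => j; rewrite ge_min lexx orbT.
move=> j; have e := shootE 0 rho j; rewrite addr0 in e.
have A0 : 0 <= 1 + lambda + j.+1%:R * rho.
  by rewrite !addr_ge0 ?mulr_ge0 // ltW.
case: (leP (shoot 0 rho j.+1) K) => qK.
  rewrite e lerD // ?ler_wpM2l ?(ltW ld0) //; by rewrite ge_min lexx.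
have Jj : (J <= j.+1)%N by rewrite leqNgt; apply: contraL qK => /ltnW /hK; rewrite leNgt.
apply: (@le_trans _ _ (K + lambda * d%:R * K)).
  by rewrite lerD // ?ler_wpM2l ?(ltW ld0) // ge_min lexx orbT.
have K0 : 0 <= K by apply: le_trans K1.
rewrite -{1}[K]mul1r -mulrDl ler_wpM2r //.
by have := hJ _ Jj; have := lambda_gt0; lra.
Qed.

(** Unit slack at all distances from [2] on. It is obtained by descending
    induction on the first distance [k] of the claim, the constant [1] being
    sufficient far away: adding a multiple of [w] cut off below [k] keeps the
    inequalities above [k] and creates the slack [w (k - 1) > 0] at [k]. *)
Lemma strict_supersolution rho w : 0 < rho ->
  [/\ w 0%N = 0, w 1%N = 1, (forall j, 0 < w j.+1), (exists K, forall j, w j <= K) &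
      forall j, w j + lambda * d%:R * w j.+2 <=
                (1 + lambda + j.+1%:R * rho) * w j.+1] ->
  exists u : nat -> R,
  [/\ u 0%N = 0, u 1%N = 0, (forall j, 0 <= u j) &
      forall j, u j.+1 + lambda * d%:R * u j.+3 + 1 <=
                (1 + lambda + j.+2%:R * rho) * u j.+2].
Proof.
move=> r0 [w0 w1 wpos _ wsup].
pose J := (Num.bound ((lambda * d%:R + 1) / rho)).+2.
have hJ j : (J <= j)%N -> lambda * d%:R + 1 <= j%:R * rho.
  move=> Jj; rewrite -ler_pdivrMr //.
  apply: (@le_trans _ _ (Num.bound ((lambda * d%:R + 1) / rho))%:R).
    by rewrite ltW // archi_boundP // divr_ge0 ?addr_ge0 ?(ltW ld0) ?(ltW r0).
  by rewrite ler_nat (leq_trans _ Jj) // /J ltnW.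
have wge0 j : 0 <= w j by case: j => [|j]; rewrite ?w0 // ltW.
pose claim k := exists u : nat -> R, [/\ (forall j, (j < k)%N -> u j = 0),
  (forall j, 0 <= u j) & forall j, (k <= j.+1)%N ->
    u j + lambda * d%:R * u j.+2 + 1 <= (1 + lambda + j.+1%:R * rho) * u j.+1].
suff H n : (n <= J - 2)%N -> claim (J - n)%N.
  have [u [u1 u2 u3]] := H _ (leqnn _); rewrite subKn // in u1 u3.
  by exists u; split=> [| | |j]; [exact: u1|exact: u1|exact: u2|exact: u3].
elim: n => [|n IH] nJ.
  rewrite subn0; exists (fun j => if (j < J)%N then 0 else 1).
  split=> [j ->//|j|j Jj]; first by case: ifP.
  rewrite [(j.+1 < J)%N]ltnNge Jj /= mulr1 [(j.+2 < J)%N]ltnNge (leqW Jj) /= mulr1.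
  have := hJ _ Jj; have := lambda_gt0; case: ifP => _; lra.
have [u [u1 u2 u3]] := IH (ltnW nJ).
set k := (J - n.+1)%N; have kS : (J - n = k.+1)%N.
  by rewrite /k subnS prednK // subn_gt0 (leq_trans nJ) // leq_subr.
rewrite kS in u1 u3; have k2 : (2 <= k)%N.
  rewrite /k leq_subRL // ?(leq_trans nJ) ?leq_subr //; move: nJ.
  by rewrite leq_subRL // addnC.
case: k k2 kS u1 u3 => [//|k] k2 kS u1 u3.
have wk : 0 < w k by case: k k2 {kS u1 u3}.
pose a := (lambda * d%:R * u k.+2 + 1) / w k.
have a0 : 0 <= a.
  apply: divr_ge0; last exact: ltW.
  by apply: addr_ge0 => //; apply: mulr_ge0 => //; exact: ltW.
exists (fun j => u j + (if (k < j)%N then a * w j else 0)); split.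
- move=> j jk; rewrite u1 ?(leq_trans jk) // ltnNge -ltnS jk addr0.
  by [].
- by move=> j; rewrite addr_ge0 //; case: ifP => // _; rewrite mulr_ge0.
move=> j kj0; have [kj|jk] := ltnP k j; last first.
  have -> : j = k by apply/eqP; rewrite eqn_leq jk -ltnS.
  rewrite /= ltnSn (leqnSn k.+1) (u1 k) // (u1 k.+1) // add0r.
  have : lambda * d%:R * u k.+2 = a * w k - 1.
    by rewrite /a divfK ?addrK // gt_eqF.
  by have := ler_wpM2l a0 (wsup k); lra.
rewrite /= !(leqW _) ?ltnS ?(ltnW kj) //.
by have := u3 j kj; have := ler_wpM2l a0 (wsup j); lra.
Qed.

(** The nonlinear form of the supersolution inequality, for weights that also pay
    [eta] for each vertex reached by blue. The weights are
    [v = e1 * (w + tau * u)]: at distance at least two, the slack of [u] pays for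
    [eta]. At distance one there is none, since [w] may be exactly harmonic
    there; both [eta] and the correction [u] are paid for by the second order
    term of the exponential. Its argument is about [e1 * Q], where
    [Q = (1 + rho) / lambda] bounds the increment of [w] due to an infection, so
    [tau] has to be of the order of [e1]. *)
Lemma capture_weights rho eps : 0 < rho -> viable rho -> 0 < eps ->
  exists (v : nat -> R) (eta : R),
  [/\ 0 < eta <= eps, v 0%N = 0, 0 <= v 1%N <= eps, (forall j, 0 <= v j) &
      forall j, lambda * (1 - expR (- (eta + (d%:R * v j.+2 - v j.+1)))) <=
                (1 + j.+1%:R * rho) * v j.+1 - v j].
Proof.
move=> r0 vi e0; have [w Hw] := bounded_supersolution r0 vi.
have [u [u0 u1 upos usup]] := strict_supersolution r0 Hw.
have {Hw} [w0 w1 wpos _ wsup] := Hw.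
have wge0 j : 0 <= w j by case: j => [|j]; rewrite ?w0 // ltW.
pose D := d%:R : R; have D0 : 0 < D by rewrite ltr0n.
pose Q := (1 + rho) / lambda; have Q0 : 0 < Q by rewrite divr_gt0 ?addr_gt0.
pose L := lambda^-1 + D * u 2%N.
have l0 : 0 < lambda^-1 by rewrite invr_gt0.
have L0 : 0 < L by rewrite ltr_wpDr // mulr_ge0 // ltW.
pose e1 := Num.min eps (2^-1) / (1 + Q).
have m0 : 0 < Num.min eps 2^-1 by rewrite lt_min e0 invr_gt0 ltr0n.
have Q10 : 0 < 1 + Q by rewrite addr_gt0.
have e10 : 0 < e1 by rewrite divr_gt0.
have e1Q : e1 * (1 + Q) = Num.min eps 2^-1 by rewrite divfK // gt_eqF.
have me : Num.min eps 2^-1 <= eps by rewrite ge_min lexx.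
have mh : Num.min eps 2^-1 <= 2^-1 by rewrite ge_min lexx orbT.
pose tau := e1 * Q ^+ 2 / 4 / L.
have tau0 : 0 < tau by rewrite !divr_gt0 // mulr_gt0 // exprn_gt0.
have tauL : tau * L = e1 * Q ^+ 2 / 4 by rewrite divfK // gt_eqF.
pose eta := e1 * tau / lambda.
have eta0 : 0 < eta by rewrite divr_gt0 // mulr_gt0.
have le1 : lambda * eta = e1 * tau by rewrite mulrC divfK // gt_eqF.
have lQ : lambda * Q = 1 + rho by rewrite mulrC divfK // gt_eqF.
have tauI : tau * lambda^-1 <= tau * L by rewrite ler_pM2l // lerDl mulr_ge0 // ltW.
have e1Q0 : 0 < e1 * Q by rewrite mulr_gt0.
have e1Q1 : e1 * Q <= 2^-1 by move: e1Q; rewrite mulrDr mulr1; lra.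
have e1Qe : e1 * Q <= eps by move: e1Q; rewrite mulrDr mulr1; lra.
have e1e : e1 <= eps by move: e1Q; rewrite mulrDr mulr1; lra.
have etaE : eta = e1 * (tau * lambda^-1) by rewrite /eta mulrA.
have bnd : e1 * (tau * L) = (e1 * Q) ^+ 2 / 4 by rewrite tauL; field.
exists (fun j => e1 * (w j + tau * u j)), eta; split.
- rewrite eta0 /=; apply: (@le_trans _ _ (e1 * (tau * L))).
    by rewrite etaE ler_pM2l.
  by rewrite bnd; nra.
- by rewrite w0 u0 mulr0 addr0 mulr0.
- by rewrite w1 u1 mulr0 addr0 mulr1 (ltW e10).
- move=> j; apply: mulr_ge0; first exact: ltW.
  by apply: addr_ge0 => //; apply: mulr_ge0 => //; exact: ltW.
case=> [|j].
  rewrite w0 w1 u0 u1 !mulr0 !addr0 mulr0 subr0 mulr1 mul1r.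
  have := wsup 0%N; rewrite w0 w1 add0r mulr1 mul1r -/D => h2.
  pose X := e1 * Q + e1 * (tau * L).
  have hx : eta + (D * (e1 * (w 2%N + tau * u 2%N)) - e1) <= X.
    rewrite etaE /X /L.
    have : D * w 2%N - 1 <= Q.
      by rewrite -(ler_pM2l lambda_gt0) lQ; move: h2; lra.
    by move=> h; have := ler_wpM2l (ltW e10) h; lra.
  have X01 : 0 <= X <= 1.
    rewrite /X bnd; set y := e1 * Q; have y0 : 0 < y by []. 
    by apply/andP; split; have := e1Q1; rewrite -/y; nra.
  apply: (@le_trans _ _ (lambda * (1 - expR (- X)))).
    by rewrite ler_pM2l // lerD2l lerN2 ler_expR lerN2.
  apply: (@le_trans _ _ (lambda * (X - X ^+ 2 / 4))).
    by rewrite ler_pM2l // expRN_quad_ge.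
  rewrite -lQ -[leRHS]mulrA (ler_pM2l lambda_gt0) [Q * e1]mulrC.
  have : (e1 * Q) ^+ 2 <= X ^+ 2.
    rewrite ler_sqr ?nnegrE ?(ltW e1Q0) //; last by case/andP: X01.
    by rewrite /X lerDl bnd divr_ge0 // sqr_ge0.
  by move: bnd; rewrite /X; lra.
apply: (@le_trans _ _ (lambda * (eta +
    (D * (e1 * (w j.+3 + tau * u j.+3)) - e1 * (w j.+2 + tau * u j.+2))))).
  by rewrite ler_pM2l // expRN_ge1B.
have h1 := ler_wpM2l (ltW e10) (wsup j.+1).
have h2 := ler_wpM2l (ltW (mulr_gt0 e10 tau0)) (usup j).
rewrite mulrDr le1 -/D; rewrite -/D in h1 h2.
by lra.
Qed.

End Shooting.

(** * Exponential functionals of a configuration *)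

Section Potential.
Context {R : realType} {d : nat}.
Variables lambda rho : R.
Hypothesis lambda_gt0 : 0 < lambda.
Hypothesis rho_gt0 : 0 < rho.
Local Notation word := (seq 'I_d).
Local Notation conf := (config (tvertex d)).
Implicit Types (c : conf) (u x y : word) (s : vstate).

Definition white_children c y : R := \sum_(i | c (Some (i :: y)) == White) 1.

Lemma white_children_ge0 c y : 0 <= white_children c y.
Proof. exact: sumr_ge0. Qed.

Lemma white_children_le c y : white_children c y <= d%:R.
Proof.
rewrite /white_children sumr_const ler_nat.
by apply: leq_trans (max_card _) _; rewrite card_ord.
Qed.

Lemma white_children_flip c u s y : s != White -> c (Some u) != White ->
  white_children (flip c u s) y = white_children c y.
Proof.
move=> s0 u0; apply: eq_bigl => i; rewrite flipE.
by case: (i :: y =P u) => [->|//]; rewrite (negbTE s0) (negbTE u0).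
Qed.

Lemma white_children_infect c i u y : c (Some (i :: u)) = White -> y != u ->
  white_children (flip c (i :: u) Red) y = white_children c y.
Proof.
move=> uw yu; apply: eq_bigl => j; rewrite flipE.
by case: (j :: y =P i :: u) => // -[_ e]; rewrite e eqxx in yu.
Qed.

Lemma white_children_infect_parent c i u : c (Some (i :: u)) = White ->
  white_children (flip c (i :: u) Red) u = white_children c u - 1.
Proof.
move=> uw; rewrite [in RHS]/white_children (bigD1 i) ?uw //= addrC addrK.
apply: eq_bigl => j; rewrite flipE.
case: (j =P i) => [->|ji]; first by rewrite eqxx andbF.
by rewrite andbT; case: (j :: u =P i :: u) => // -[].
Qed.

Lemma white_children_new c i u : tree_inv c -> c (Some (i :: u)) = White ->
  white_children (flip c (i :: u) Red) (i :: u) = d%:R.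
Proof.
move=> ci uw; rewrite /white_children.
rewrite (eq_bigl xpredT) ?sumr_const ?card_ord // => j.
rewrite flipE; case: (j :: i :: u =P i :: u) => [e|_].
  by have := congr1 size e => /= /eqP; rewrite -[X in _ == X]addn0 -addn1 eqn_add2l.
by rewrite (white_child ci _ uw).
Qed.

(** The weight of a white vertex depends on a label of its parent. A new red
    vertex has a label [nxt l] determined by the label [l] of its parent, and the
    other labels are not affected by an infection. *)
Section Label.
Context {L : Type}.
Variables (lab : conf -> word -> L) (nxt : L -> L) (sg v : L -> R).
Hypothesis lab_infect : forall c x y, tree_inv c -> c (Some x) = White ->
  c (Some y) != White -> lab (flip c x Red) y = lab c y.
Hypothesis lab_new : forall c i u, tree_inv c -> c (Some u) = Red ->
  c (Some (i :: u)) = White -> lab (flip c (i :: u) Red) (i :: u) = nxt (lab c u).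

(** The weighted white vertices are grouped by their parents, because captures and
    deaths change neither this index set nor the number of white children. *)
Definition potential c :=
  \sum_(y <- words c) (sg (lab c y) + white_children c y * v (lab c y)).

Definition infect_cost c u :=
  sg (nxt (lab c u)) + d%:R * v (nxt (lab c u)) - v (lab c u).

Definition change k (l' l : L) : R := (sg l' - sg l) + k * (v l' - v l).

Lemma potential_infect c i u : tree_inv c -> c (Some u) = Red ->
  c (Some (i :: u)) = White ->
  potential (flip c (i :: u) Red) = potential c + infect_cost c u.
Proof.
move=> ci ur uw; rewrite /potential (perm_big _ (words_infect _ uw)) //= big_cons.
rewrite (white_children_new ci uw) (lab_new ci ur uw).
have uc : u \in words c by rewrite mem_words ur.
have um : u \notin rem u (words c).
  by rewrite mem_rem_uniq ?words_uniq // inE eqxx.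
rewrite !(perm_big _ (perm_to_rem uc)) /= !big_cons.
rewrite (white_children_infect_parent uw) (lab_infect ci uw) ?ur //.
rewrite (eq_big_seq (fun y => sg (lab c y) + white_children c y * v (lab c y))).
  by rewrite /infect_cost; ring.
move=> y yr; have yc : y \in words c by apply: mem_rem yr.
rewrite (lab_infect ci uw) -?mem_words // (white_children_infect uw) //.
by apply/eqP => yu; move: um; rewrite -{1}yu yr.
Qed.

Lemma potential_flip c u s : s != White -> c (Some u) != White ->
  potential (flip c u s) - potential c =
  \sum_(y <- words c) change (white_children c y) (lab (flip c u s) y) (lab c y).
Proof.
move=> s0 u0; rewrite /potential (perm_big _ (words_flip s0 u0)) /= -sumrB.
by apply: eq_bigr => y _; rewrite (white_children_flip _ s0 u0) /change; ring.
Qed.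

(** In the bounds below, [f] is the exact or the quadratic effect of an infection
    on [exp (- potential)], up to sign. *)
Definition drift (f : R -> R) c y :=
  (c (Some y) == Red)%:R * (lambda * (white_children c y * f (infect_cost c y))).

Lemma gen_expE c : tree_inv c ->
  gen lambda rho (fun c => expR (- potential c)) c =
  expR (- potential c) * rate_sum lambda rho c
    (fun u s => expR (- (potential (flip c u s) - potential c)) - 1).
Proof.
move=> ci; rewrite /gen -rate_sumZ.
apply: eq_rate_sum => // m _.
by rewrite mulrBr mulr1 -expRD; congr (expR _ - _); ring.
Qed.

(** Captures and deaths change many terms of the potential at once. By
    [1 - x <= exp (- x)] their effect is at least linear, and the linear terms
    can be regrouped by the vertex [y] whose weight changes; the infections are
    kept in exact form, because the critical cases rely on their second order
    term. *)
Lemma gen_exp_ge0 c : tree_inv c ->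
  (forall y, c (Some y) != White ->
     \sum_(u <- words c | c (Some u) == Red) (c (par u) == Blue)%:R *
        change (white_children c y) (lab (flip c u Blue) y) (lab c y) +
     rho * \sum_(u <- words c | c (Some u) == Red)
        change (white_children c y) (lab (flip c u Dead) y) (lab c y) <=
     drift (fun z => expR (- z) - 1) c y) ->
  0 <= gen lambda rho (fun c => expR (- potential c)) c.
Proof.
move=> ci H; rewrite gen_expE // pmulr_rge0 ?expR_gt0 //.
rewrite /rate_sum.
apply: (@le_trans _ _ (\sum_(u <- words c | c (Some u) == Red)
   (lambda * (white_children c u * (expR (- infect_cost c u) - 1))
    - (c (par u) == Blue)%:R * \sum_(y <- words c)
         change (white_children c y) (lab (flip c u Blue) y) (lab c y)
    - rho * \sum_(y <- words c)
         change (white_children c y) (lab (flip c u Dead) y) (lab c y)))); last first.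
  apply: ler_sum => u /eqP ur; have u0 : c (Some u) != White by rewrite ur.
  have ex (z : R) : - z <= expR (- z) - 1 by have := expRN_ge1B z; lra.
  rewrite !lerD //; last 2 first.
  - by rewrite -mulrN ler_wpM2l // -(potential_flip _ u0).
  - by rewrite -mulrN ler_pM2l // -(potential_flip _ u0).
  rewrite ler_pM2l // /white_children mulr_suml; apply: ler_sum => i /eqP iw.
  by rewrite mul1r (potential_infect ci ur iw) addrAC subrr add0r.
rewrite !sumrB /=.
under [X in _ - X - _]eq_bigr do rewrite mulr_sumr.
rewrite -[X in _ - X]mulr_sumr [X in _ - X - _]exchange_big.
rewrite [X in _ - rho * X]exchange_big /= [X in X - _ - _]big_mkcond /=.
rewrite mulr_sumr -!sumrB.
rewrite big_seq; apply: sumr_ge0 => y; rewrite mem_words => yw.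
have := H y yw; rewrite /drift.
by case: ifP => _; rewrite ?mul1r ?mul0r; lra.
Qed.

(** The upper bound [exp (- x) <= 1 - x + x ^ 2] has a quadratic term. When the
    total change [x] caused by one flip is at most [C], this term is at most [C]
    times the sum of the absolute changes, which is linear again and can be
    regrouped as in [gen_exp_ge0]. *)
Lemma gen_exp_le0 c (C : R) : tree_inv c -> 0 <= C <= 1 / 4 ->
  (forall u, c (Some u) = Red -> `|infect_cost c u| <= 1 / 4) ->
  (forall u s, c (Some u) = Red -> (s = Blue /\ c (par u) = Blue) \/ s = Dead ->
     \sum_(y <- words c)
       `|change (white_children c y) (lab (flip c u s) y) (lab c y)| <= C) ->
  (forall y, c (Some y) != White ->
     drift (fun z => z - z ^+ 2) c y +
     \sum_(u <- words c | c (Some u) == Red) (c (par u) == Blue)%:R *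
        (change (white_children c y) (lab (flip c u Blue) y) (lab c y) -
         C * `|change (white_children c y) (lab (flip c u Blue) y) (lab c y)|) +
     rho * \sum_(u <- words c | c (Some u) == Red)
        (change (white_children c y) (lab (flip c u Dead) y) (lab c y) -
         C * `|change (white_children c y) (lab (flip c u Dead) y) (lab c y)|) >= 0) ->
  gen lambda rho (fun c => expR (- potential c)) c <= 0.
Proof.
move=> ci /andP[C0 C14] Hinf HC H; rewrite gen_expE // pmulr_rle0 ?expR_gt0 //.
have bound u s : c (Some u) = Red -> (s = Blue /\ c (par u) = Blue) \/ s = Dead ->
  expR (- (potential (flip c u s) - potential c)) - 1 <=
  - \sum_(y <- words c)
      (change (white_children c y) (lab (flip c u s) y) (lab c y) -
       C * `|change (white_children c y) (lab (flip c u s) y) (lab c y)|).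
  move=> ur sBD; have u0 : c (Some u) != White by rewrite ur.
  have s0 : s != White by case: sBD => [[->]|->].
  rewrite (potential_flip s0 u0) sumrB -mulr_sumr.
  have hC := HC u s ur sBD; set z := \sum_(y <- _) _.
  set a := \sum_(y <- _) `|_| in hC *.
  have za : `|z| <= a by exact: ler_norm_sum.
  have z14 : `|z| <= 1 / 4 by apply: le_trans za _; apply: le_trans hC _.
  have := expRN_quad_le z14.
  have : z ^+ 2 <= C * a.
    rewrite -real_normK ?num_real // expr2; apply: ler_pM => //.
    exact: le_trans za hC.
  by lra.
rewrite /rate_sum.
apply: (@le_trans _ _ (\sum_(u <- words c | c (Some u) == Red)
   (- (lambda * (white_children c u * (infect_cost c u - infect_cost c u ^+ 2)))
    - (c (par u) == Blue)%:R * \sum_(y <- words c)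
         (change (white_children c y) (lab (flip c u Blue) y) (lab c y) -
          C * `|change (white_children c y) (lab (flip c u Blue) y) (lab c y)|)
    - rho * \sum_(y <- words c)
         (change (white_children c y) (lab (flip c u Dead) y) (lab c y) -
         C * `|change (white_children c y) (lab (flip c u Dead) y) (lab c y)|)))).
  apply: ler_sum => u /eqP ur.
  rewrite !lerD //; last 2 first.
  - case: eqP => [pb|_]; last by rewrite !mul0r oppr0.
    by rewrite !mul1r; apply: bound => //; left.
  - by rewrite -[leRHS]mulrN ler_pM2l //; apply: bound => //; right.
  rewrite -mulrN ler_pM2l // -mulrN /white_children mulr_suml.
  apply: ler_sum => i /eqP iw.
  rewrite mul1r (potential_infect ci ur iw) addrAC subrr add0r.
  by have := expRN_quad_le (Hinf u ur); lra.
rewrite !sumrB /=.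
under [X in _ - X - _]eq_bigr do rewrite mulr_sumr.
rewrite -[X in _ - X]mulr_sumr [X in _ - X - _]exchange_big.
rewrite [X in _ - rho * X]exchange_big /= [X in X - _ - _]big_mkcond /=.
rewrite mulr_sumr -!sumrB.
rewrite big_seq; apply: sumr_le0 => y; rewrite mem_words => yw.
have := H y yw; rewrite /drift.
by case: ifP => _; rewrite ?mul1r ?mul0r; lra.
Qed.

End Label.

End Potential.

(** * The distance to the nearest blue ancestor *)

Section Level.
Context {d : nat}.
Local Notation word := (seq 'I_d).
Local Notation conf := (config (tvertex d)).
Implicit Types (c : conf) (u x y : word) (s : vstate).

Definition step_lev s (a : option nat) :=
  match s with Blue => Some 0%N | Red => omap S a | _ => None end.

(** The distance along red vertices from [u] up to the blue front. A dead vertex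
    separates [u] from blue forever, hence [None]. The value [Some 0] above the
    root stands for the extra vertex. *)
Fixpoint lev c u : option nat :=
  step_lev (c (Some u)) (if u is _ :: u' then lev c u' else Some 0%N).

Definition plev c u := if u is _ :: u' then lev c u' else Some 0%N.

Lemma levE c u : lev c u = step_lev (c (Some u)) (plev c u).
Proof. by case: u. Qed.

Lemma plev_blue c u : tree_inv c -> (c (par u) == Blue) = (plev c u == Some 0%N).
Proof.
move=> [c0 _ _ _]; case: u => [|i u] /=; first by rewrite c0.
by rewrite levE; case: (c (Some u)) => //=; case: (plev c u).
Qed.

Lemma lev_infect c x y : tree_inv c -> c (Some x) = White ->
  c (Some y) != White -> lev (flip c x Red) y = lev c y.
Proof.
move=> [_ _ cw _] xw; elim: y => [|i y IH] yw; rewrite !levE flipE /=.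
  by case: ([::] =P x) => // e; rewrite e xw eqxx in yw.
rewrite IH; last exact: cw yw.
by case: (i :: y =P x) => // e; rewrite e xw eqxx in yw.
Qed.

Lemma lev_new c i u : tree_inv c -> c (Some u) = Red ->
  c (Some (i :: u)) = White -> lev (flip c (i :: u) Red) (i :: u) = omap S (lev c u).
Proof.
move=> ci ur uw; rewrite levE flip_same /= lev_infect //.
by rewrite ur.
Qed.

Lemma lev_flip_long c u s y : (size y < size u)%N -> lev (flip c u s) y = lev c y.
Proof.
elim: y => [|i y IH] yu; rewrite !levE flipE /=.
  by case: ([::] =P u) => // e; rewrite -e in yu.
rewrite IH; last exact: ltn_trans yu.
by case: (i :: y =P u) => // e; rewrite -e ltnn in yu.
Qed.

(** The distance to the blue ancestor sees a flip at [u] only if [u] is on the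
    red path up to that ancestor. *)
Lemma lev_change c u s y : tree_inv c -> c (Some u) = Red ->
  (s = Blue /\ c (par u) = Blue) \/ s = Dead ->
  lev (flip c u s) y != lev c y ->
  exists z j, [/\ y = z ++ u, lev c y = Some j, (size z < j)%N,
    (s = Blue -> j = (size z).+1) &
    lev (flip c u s) y = if s == Blue then Some (size z) else None].
Proof.
move=> ci ur sBD.
have own : lev (flip c u s) u != lev c u ->
    exists j, [/\ lev c u = Some j, (0 < j)%N, (s = Blue -> j = 1%N) &
      lev (flip c u s) u = if s == Blue then Some 0%N else None].
  rewrite !levE flip_same ur /=.
  case: sBD => [[-> /eqP]|->] /=.
    by rewrite plev_blue // => /eqP -> _; exists 1%N.
  by case: (plev c u) => [j|] //= _; exists j.+1.
elim: y => [|i y IH].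
  have [<- /own[j [h1 h2 h3 h4]]|ne] := eqVneq u [::].
    by exists [::], j.
  by rewrite !levE flipE [_ == u]eq_sym (negbTE ne) eqxx.
have [e|ne] := eqVneq u (i :: y).
  by rewrite -e => /own[j [h1 h2 h3 h4]]; exists [::], j.
rewrite !levE flipE [_ == u]eq_sym (negbTE ne) /=.
case: (c (Some (i :: y))) => //=; rewrite ?eqxx //.
have [->|/IH] := eqVneq (lev (flip c u s) y) (lev c y); first by rewrite eqxx.
move=> [z [j [yz ly zj jB ->]]] _; exists (i :: z), j.+1.
split=> //; [by rewrite yz|by rewrite ly|by move=> /jB ->|by case: ifP].
Qed.

Context {R : realType}.
Implicit Types Phi : option nat -> option nat -> R.

(** Flipping [y] itself is singled out from the flips that reach the label of
    [y] only through its parent. *)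
Lemma split_sum c y (F G : word -> R) :
  F y = 0 -> (forall u, u != y -> G u = F u) ->
  \sum_(u <- words c | c (Some u) == Red) G u =
  (c (Some y) == Red)%:R * G y + \sum_(u <- words c | c (Some u) == Red) F u.
Proof.
move=> F0 FG; have [yr|yr] := eqVneq (c (Some y)) Red; last first.
  rewrite mul0r add0r; apply: eq_bigr => u ur; apply: FG.
  by apply: contraNneq yr => <-.
have yc : y \in words c by rewrite mem_words yr.
rewrite mul1r (eq_bigr (fun u => (u == y)%:R * G y + F u)); last first.
  move=> u _; have [->|uy] := eqVneq u y; first by rewrite mul1r F0 addr0.
  by rewrite mul0r add0r FG.
rewrite big_split /=; congr (_ + _).
rewrite (perm_big _ (perm_to_rem yc)) /= big_cons yr !eqxx mul1r big1_seq ?addr0 //.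
move=> u /andP[_]; rewrite mem_rem_uniq ?words_uniq // inE => /andP[/negbTE -> _].
by rewrite mul0r.
Qed.

(** Among the captures, exactly one changes the distance from [y] to blue: that
    of the topmost red vertex above [y], which decreases this distance by one.
    [Phi a a = 0] makes all other terms vanish. *)
Lemma capture_sum c y Phi : tree_inv c -> (forall a, Phi a a = 0) ->
  \sum_(u <- words c | c (Some u) == Red)
     (c (par u) == Blue)%:R * Phi (lev (flip c u Blue) y) (lev c y) =
  if lev c y is Some j.+1 then Phi (Some j) (Some j.+1) else 0.
Proof.
move=> ci; elim: y Phi => [|i y IH] Phi P0.
  rewrite (@split_sum c [::] (fun=> 0)) //; last first.
    move=> u u0; rewrite [lev (flip _ _ _) _]levE [lev c _]levE flipE.
    rewrite [_ == u]eq_sym (negbTE u0) /=.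
    by rewrite P0 mulr0.
  rewrite big1 // addr0 plev_blue // !levE flip_same /= ?mul1r.
  by case: (c (Some [::])) => /=; rewrite ?mul0r ?mul1r.
rewrite (@split_sum c (i :: y) (fun u => (c (par u) == Blue)%:R *
   (if c (Some (i :: y)) is Red
    then Phi (omap S (lev (flip c u Blue) y)) (omap S (lev c y)) else 0))); last first.
- move=> u uy; congr (_ * _).
  rewrite [lev (flip _ _ _) _]levE [lev c (_ :: _)]levE flipE.
  rewrite [_ == u]eq_sym (negbTE uy) /=.
  by case: (c (Some (i :: y))) => /=; rewrite ?P0.
- by rewrite lev_flip_long // P0; case: (c (Some (i :: y))); rewrite mulr0.
rewrite plev_blue // ![lev _ (_ :: _)]levE flip_same /=.
case: (c (Some (i :: y))) => /=; try by rewrite mul0r add0r big1 // => u _; rewrite mulr0.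
have /= -> := IH (fun a b => Phi (omap S a) (omap S b)) (fun a => P0 _).
rewrite mul1r.
by case: (lev c y) => [[|j]|] /=; rewrite ?mul1r ?mul0r ?addr0 ?add0r.
Qed.

(** The death of any of the [j] red vertices between [y] and blue cuts [y]
    off. *)
Lemma death_sum c y Phi : (forall a, Phi a a = 0) ->
  \sum_(u <- words c | c (Some u) == Red) Phi (lev (flip c u Dead) y) (lev c y) =
  if lev c y is Some j then j%:R * Phi None (Some j) else 0.
Proof.
elim: y Phi => [|i y IH] Phi P0.
  rewrite (@split_sum c [::] (fun=> 0)) //; last first.
    move=> u u0; rewrite [lev (flip _ _ _) _]levE [lev c _]levE flipE.
    rewrite [_ == u]eq_sym (negbTE u0) /=.
    by rewrite P0.
  rewrite big1 // addr0 !levE flip_same /=.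
  by case: (c (Some [::])) => /=; rewrite ?mul0r ?mul1r.
rewrite (@split_sum c (i :: y) (fun u =>
   (if c (Some (i :: y)) is Red
    then Phi (omap S (lev (flip c u Dead) y)) (omap S (lev c y)) else 0))); last first.
- move=> u uy.
  rewrite [lev (flip _ _ _) _]levE [lev c (_ :: _)]levE flipE.
  rewrite [_ == u]eq_sym (negbTE uy) /=.
  by case: (c (Some (i :: y))) => /=; rewrite ?P0.
- by rewrite lev_flip_long //= P0; case: (c _).
rewrite ![lev _ (_ :: _)]levE flip_same /=.
case: (c (Some (i :: y))) => /=; try by rewrite !mul0r add0r big1.
have /= -> := IH (fun a b => Phi (omap S a) (omap S b)) (fun a => P0 _).
rewrite mul1r.
case: (lev c y) => [j|] /=; last by rewrite P0 addr0.
by rewrite -[in RHS]natr1 mulrDl mul1r addrC.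
Qed.

End Level.

(** * Four bounds on the number of reached and of blue vertices *)

Lemma sumr_const_seq (R : pzSemiRingType) (I : Type) (r : seq I) (P : pred I)
    (x : R) : \sum_(i <- r | P i) x = x * (count P r)%:R.
Proof. by rewrite big_const_seq iter_addr_0 mulr_natr. Qed.

Section Means.
Context {R : realType} {d : nat}.
Variables lambda rho : R.
Hypothesis d_ge2 : (2 <= d)%N.
Hypothesis lambda_gt0 : 0 < lambda.
Hypothesis rho_gt0 : 0 < rho.
Local Notation word := (seq 'I_d).
Local Notation conf := (config (tvertex d)).
Local Notation q := (ced_rate (@tadj d) lambda rho).
Local Notation x0 := (tree_init d).
Local Notation mean := (mean q (@succ d) x0).
Local Notation reach := (reach q (@succ d) x0).
Implicit Types (c : conf) (u x y : word) (s : vstate).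

Let fb := @ced_finite_branching R d lambda rho lambda_gt0 rho_gt0.
Let d_gt0 : (0 < d)%N. Proof. exact: leq_trans d_ge2. Qed.
Let dR_gt0 : 0 < d%:R :> R. Proof. by rewrite ltr0n. Qed.
Let dR_ge2 : 2 <= d%:R :> R. Proof. by rewrite ler_nat. Qed.

(** The mean of [exp (- pot)] is nondecreasing in time. It starts near [1], but
    the event that [M] is at least [K] only contributes [exp (- eta * K)]. *)
Lemma rare_growth (M : conf -> nat) (pot : conf -> R) (eta eps : R) :
  0 < eta -> 0 < eps -> (forall c, eta * (M c)%:R <= pot c) ->
  (forall n c, reach n c -> 0 <= gen lambda rho (fun c => expR (- pot c)) c) ->
  pot x0 <= eps / 2 ->
  exists K, forall n, mean n (fun c => (K <= M c)%N%:R) <= eps.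
Proof.
move=> eta0 eps0 potM gen0 pot0.
have [K hK] : exists K : nat, 2 / (eta * eps) < K%:R.
  exists (Num.bound (2 / (eta * eps))).
  by rewrite archi_boundP // divr_ge0 // mulr_ge0 // ltW.
exists K => n.
have K0 : 0 < K%:R :> R by apply: lt_trans hK; rewrite divr_gt0 ?mulr_gt0.
have eK0 : 0 < eta * K%:R by rewrite mulr_gt0.
have eK : expR (- (eta * K%:R)) <= eps / 2.
  rewrite expRN; apply: (@le_trans _ _ (eta * K%:R)^-1).
    rewrite lef_pV2 ?posrE ?expR_gt0 //.
    by have := expR_ge1Dx (eta * K%:R); lra.
  rewrite -[leRHS]invrK lef_pV2 ?posrE // ?invr_gt0 ?divr_gt0 //.
  rewrite invf_div; move: hK; rewrite ltr_pdivrMr ?mulr_gt0 // => h.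
  by rewrite ler_pdivrMr //; nra.
have h1 : mean n (fun c => (K <= M c)%N%:R) <=
    mean n (fun c => -1 * expR (- pot c) + (1 + eps / 2)).
  apply: (mean_le fb) => c _; case: leqP => [KM|_].
    have : expR (- pot c) <= expR (- (eta * K%:R)).
      rewrite ler_expR lerN2; apply: le_trans (potM c).
      by rewrite ler_pM2l // ler_nat.
    by rewrite /=; lra.
  have : expR (- pot c) <= 1.
    rewrite -expR0 ler_expR oppr_le0; apply: le_trans (potM c).
    by rewrite mulr_ge0 // ltW.
  by rewrite /=; lra.
apply: le_trans h1 _; rewrite (mean_affine fb).
have h2 : expR (- pot x0) <= mean n (fun c => expR (- pot c)).
  apply: (mean_incr fb) => m c rc.
  exact: (gen_ge0_step lambda_gt0 rho_gt0 rc (gen0 _ _ rc)).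
have h3 := @expRN_ge1B R (pot x0).
by lra.
Qed.

(** The mean of [exp (- pot)] is nonincreasing after time [n0]. If [M] remains
    below [K], then either [pot = 0], which has at most this mean as its
    probability, or [pot > 0]; by [transience], the latter becomes unlikely,
    because then [M] has a chance to grow in each jump. *)
Lemma likely_growth (M : conf -> nat) (pot : conf -> R) (kappa : R) n0 :
  0 < kappa -> (forall c, 0 <= pot c) ->
  (forall n c, reach n c -> gen lambda rho (fun c => expR (- pot c)) c <= 0) ->
  (forall n c K, reach n c ->
     kappa * ((0 < pot c) && (M c < K)%N)%:R <=
     gen lambda rho (fun c => (minn (M c) K)%:R) c) ->
  forall K eps, 0 < eps -> exists n,
    1 - mean n0 (fun c => expR (- pot c)) - eps <=
    mean n (fun c => (K <= M c)%N%:R).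
Proof.
move=> k0 pot0 gen0 genM K eps eps0.
have C0 : 0 < lambda * d%:R + 1 + rho.
  by rewrite ltr_wpDl // addr_ge0 // mulr_ge0 ?ler0n // ltW.
have [| |n n0n hn] := @transience _ _ _ _ _ fb (fun c => (minn (M c) K)%:R)
    (fun c => (0 < pot c) && (M c < K)%N) K%:R _ eps n0 (divr_gt0 k0 C0) eps0.
- by move=> c; rewrite ler0n ler_nat geq_minr.
- by move=> m c rc; exact: (gen_step_lb lambda_gt0 rho_gt0 rc (ltW k0) (genM _ _ _ rc)).
exists n.
have h1 : mean n (fun c => expR (- pot c)) <= mean n0 (fun c => expR (- pot c)).
  apply: (mean_decr fb) => // m c rc.
  exact: (gen_le0_step lambda_gt0 rho_gt0 rc (gen0 _ _ rc)).
have : mean n (fun c => -1 * (K <= M c)%N%:R + 1) <=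
  mean n (fun c => expR (- pot c) + ((0 < pot c) && (M c < K)%N)%:R).
  apply: (mean_le fb) => c _; have e0 := expR_gt0 (- pot c).
  have := pot0 c; rewrite le_eqVlt => /predU1P[<-|p0].
    by rewrite oppr0 expR0 ltxx /=; case: leqP => _ /=; lra.
  by rewrite p0 /=; case: leqP => _ /=; lra.
have /= -> := mean_affine fb n (-1) 1 (fun c => (K <= M c)%N%:R).
by rewrite meanD; lra.
Qed.


Lemma potential_init (L : Type) (lab : conf -> word -> L) (sg v : L -> R) :
  potential lab sg v x0 = sg (lab x0 [::]) + d%:R * v (lab x0 [::]).
Proof.
rewrite /potential words_init big_seq1 /white_children.
rewrite (eq_bigl xpredT) ?sumr_const ?card_ord // => i.
by rewrite tree_initE.
Qed.

Definition is_red c y : bool := c (Some y) == Red.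

Lemma is_red_infect c x y : tree_inv c -> c (Some x) = White ->
  c (Some y) != White -> is_red (flip c x Red) y = is_red c y.
Proof.
move=> _ xw yw; rewrite /is_red flipE.
by case: (y =P x) => // e; rewrite e xw eqxx in yw.
Qed.

Lemma is_red_new c i u : tree_inv c -> c (Some u) = Red ->
  c (Some (i :: u)) = White -> is_red (flip c (i :: u) Red) (i :: u) = id (is_red c u).
Proof. by move=> _ ur _; rewrite /is_red flip_same ur. Qed.

Lemma is_red_flip c u s y : s != Red ->
  is_red (flip c u s) y = (y != u) && is_red c y.
Proof.
by move=> sr; rewrite /is_red flipE; case: (y =P u) => _; rewrite ?(negbTE sr).
Qed.

(** In the critical case the first order terms cancel, so that [eta] has to be
    of second order in the weight [a]. *)
Lemma red_rare eps : lambda * (d%:R - 1) <= rho -> 0 < eps ->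
  exists K, forall n, mean n (fun c => (K <= size (words c))%N%:R) <= eps.
Proof.
move=> hrho eps0; pose a := Num.min 1 eps / (4 * d%:R).
have m0 : 0 < Num.min 1 eps by rewrite lt_min ltr01.
have m1 : Num.min 1 eps <= 1 by rewrite ge_min lexx.
have me : Num.min 1 eps <= eps by rewrite ge_min lexx orbT.
have a0 : 0 < a by rewrite divr_gt0 // mulr_gt0.
have da : d%:R * a = Num.min 1 eps / 4 by rewrite /a; field; rewrite gt_eqF.
pose z := (d%:R - 1) * a; have z0 : 0 < z by rewrite mulr_gt0 //; have := dR_ge2; lra.
have zda : z <= d%:R * a by rewrite /z; lra.
pose eta := z ^+ 2 / 4; have eta0 : 0 < eta by rewrite divr_gt0 // exprn_gt0.
have etaz : eta <= z by rewrite /eta; nra.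
pose v b : R := if b then a else 0.
have v0 b : 0 <= v b by rewrite /v; case: b => //; exact: ltW.
apply: (@rare_growth _ (potential is_red (fun=> eta) v) eta) => //.
- move=> c; rewrite -count_predT -sumr_const_seq; apply: ler_sum => y _.
  by rewrite lerDl mulr_ge0 // white_children_ge0.
- move=> n c /reach_inv ci.
  apply: (gen_exp_ge0 lambda_gt0 rho_gt0 is_red_infect is_red_new ci) => y yw.
  have k0 := @white_children_ge0 R _ c y; set k := white_children c y in k0 *.
  rewrite [X in X + rho * _](@split_sum d R c y (fun=> 0)) //; last first.
    move=> u uy; rewrite is_red_flip // [y == u]eq_sym uy /= /change.
    by rewrite !subrr mulr0 addr0 ?mulr0.
  rewrite [X in rho * X](@split_sum d R c y (fun=> 0)) //; last first.
    move=> u uy; rewrite is_red_flip // [y == u]eq_sym uy /= /change.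
    by rewrite !subrr mulr0 addr0 ?mulr0.
  rewrite !big1 // !addr0 /drift /change !is_red_flip // eqxx /= -/k.
  rewrite /infect_cost /is_red.
  case: (c (Some y) == Red); last by rewrite !mul0r mulr0 addr0.
  rewrite !mul1r /v subrr add0r sub0r.
  have -> : eta + d%:R * a - a = eta + z by rewrite /z; ring.
  have e1 : 1 - expR (- (eta + z)) <= z.
    apply: le_trans (expRN_quad_ge _) _; first by rewrite /eta; nra.
    by rewrite /eta; nra.
  have e2 : lambda * (1 - expR (- (eta + z))) <= rho * a.
    apply: (@le_trans _ _ (lambda * z)); first by rewrite ler_pM2l.
    by rewrite /z mulrA ler_pM2r.
  have e3 : 0 <= (c (par y) == Blue)%:R * (k * a) :> R.
    by rewrite mulr_ge0 // mulr_ge0 // ltW.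
  have := ler_wpM2l k0 e2; lra.
- rewrite potential_init /is_red tree_initE /= /v; lra.
Qed.

Lemma lev_init : lev x0 [::] = Some 1%N.
Proof. by rewrite levE tree_initE. Qed.

Lemma blue_rare eps : viable (d := d) lambda rho -> 0 < eps ->
  exists K, forall n, mean n (fun c => (K <= blues c)%N%:R) <= eps.
Proof.
move=> vi eps0.
have e20 : 0 < eps / (2 * (1 + d%:R)) by rewrite divr_gt0 // mulr_gt0 // addr_gt0.
have [v [eta [/andP[eta0 etae] v0 /andP[v10 v1e] vpos hv]]] :=
  capture_weights d_gt0 lambda_gt0 rho_gt0 vi e20.
pose sg (l : option nat) : R := if l is Some _ then eta else 0.
have sg0 l : 0 <= sg l by case: l => //= _; exact: ltW.
have ov0 l : 0 <= oapp v 0 l by case: l => /=.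
apply: (@rare_growth _ (potential (@lev d) sg (oapp v 0)) eta) => //.
- move=> c; rewrite /blues -sumr_const_seq big_mkcond; apply: ler_sum => y _.
  case: eqP => [yb|_].
    by rewrite levE yb /= lerDl mulr_ge0 // white_children_ge0.
  by rewrite addr_ge0 // mulr_ge0 // white_children_ge0.
- move=> n c /reach_inv ci.
  apply: (gen_exp_ge0 lambda_gt0 rho_gt0 (@lev_infect d) (@lev_new d) ci) => y yw.
  have k0 := @white_children_ge0 R _ c y; set k := white_children c y in k0 *.
  have ch0 a : change sg (oapp v 0) k a a = 0.
    by rewrite /change !subrr mulr0 addr0.
  rewrite (@capture_sum d R c y (change sg (oapp v 0) k)) //.
  rewrite (@death_sum d R c y (change sg (oapp v 0) k)) //.
  rewrite /drift /infect_cost -/k.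
  case ly: (lev c y) => [[|j]|] /=.
  + rewrite mul0r mulr0 addr0.
    have -> : (c (Some y) == Red) = false.
      by move: ly; rewrite levE; case: (c (Some y)) => //=; case: (plev c y).
    by rewrite mul0r.
  + have -> : (c (Some y) == Red) = true.
      by move: ly; rewrite levE; case: (c (Some y)).
    rewrite mul1r /change /= subrr add0r.
    have := ler_wpM2l k0 (hv j); rewrite addrA.
    have : 0 <= rho * (j.+1%:R * eta) by rewrite mulr_ge0 ?mulr_ge0 // ltW.
    rewrite !sub0r; lra.
  + rewrite mulr0 addr0 mulr0 addr0 subr0 oppr0 expR0 subrr !mulr0.
    by [].
- rewrite potential_init lev_init /=.
  have := ler_wpM2l (ltW dR_gt0) v1e.
  have -> : eps / 2 = eps / (2 * (1 + d%:R)) + d%:R * (eps / (2 * (1 + d%:R))).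
    by field; rewrite gt_eqF // addr_gt0.
  by lra.
Qed.

Lemma white_children_gt0 c y : 0 < white_children c y :> R ->
  exists i, c (Some (i :: y)) = White.
Proof.
rewrite /white_children; case: (pickP (fun i => c (Some (i :: y)) == White)).
  by move=> i /eqP iw; exists i.
by move=> no; rewrite big_pred0 // ltxx.
Qed.

Lemma potential_gt0 (L : Type) (lab : conf -> word -> L) (v : L -> R) c :
  (forall l, 0 <= v l) -> 0 < potential lab (fun=> 0) v c ->
  exists y, [/\ c (Some y) != White, 0 < v (lab c y) &
                0 < white_children c y :> R].
Proof.
move=> v0 p0; apply: contrapT => no; move: p0; apply/negP; rewrite -leNgt.
rewrite /potential big_seq; apply: sumr_le0 => y; rewrite mem_words => yw.
rewrite add0r leNgt; apply/negP => h; apply: no; exists y; split=> //.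
  rewrite lt_neqAle v0 andbT eq_sym; apply: contraTneq h => ->.
  by rewrite mulr0 ltxx.
rewrite lt_neqAle white_children_ge0 andbT eq_sym; apply: contraTneq h => ->.
by rewrite mul0r ltxx.
Qed.

(** Once the root is dead, no red vertex has a blue neighbour anymore. *)
Definition free_red c y := (c (Some [::]) == Dead) && (c (Some y) == Red).

Lemma free_red_infect c x y : tree_inv c -> c (Some x) = White ->
  c (Some y) != White -> free_red (flip c x Red) y = free_red c y.
Proof.
move=> [_ cr _ _] xw yw; rewrite /free_red !flipE.
case: ([::] =P x) => [e|_]; first by rewrite e xw eqxx in cr.
by case: (y =P x) => // e; rewrite e xw eqxx in yw.
Qed.

Lemma free_red_new c i u : tree_inv c -> c (Some u) = Red ->
  c (Some (i :: u)) = White ->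
  free_red (flip c (i :: u) Red) (i :: u) = id (free_red c u).
Proof. by move=> _ ur _; rewrite /free_red flip_same ur flipE. Qed.

Lemma root_dead_not_chased c u : tree_inv c -> c (Some [::]) = Dead ->
  c (Some u) = Red -> c (par u) != Blue.
Proof.
move=> [c0 _ _ cb] rd; case: u => [|i u] /=; first by rewrite rd.
move=> _; elim: u => [|j u IH]; first by rewrite rd.
by apply: contraNneq IH => /cb ->.
Qed.

Lemma red_likely : rho < lambda * (d%:R - 1) -> exists2 delta, 0 < delta &
  forall K eps, 0 < eps -> exists n,
    delta - eps <= mean n (fun c => (K <= size (words c))%N%:R).
Proof.
move=> hrho; pose D := d%:R : R.
pose B := lambda * (D - 1) ^+ 2 + rho * D.
have D1 : 0 < D - 1 by have := dR_ge2; rewrite -/D; lra.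
have B0 : 0 < B by rewrite addr_gt0 // mulr_gt0 // exprn_gt0.
pose e := Num.min (1 / (4 * D)) ((lambda * (D - 1) - rho) / B).
have e0 : 0 < e.
  by rewrite lt_min !divr_gt0 ?mulr_gt0 // subr_gt0.
have eD : e * D <= 1 / 4.
  rewrite -ler_pdivlMr //; apply: (@le_trans _ _ (1 / (4 * D))).
    by rewrite ge_min lexx.
  by rewrite invfM mulrA !mul1r.
have eB : e * B <= lambda * (D - 1) - rho.
  by rewrite -ler_pdivlMr // ge_min lexx orbT.
pose v b : R := if b then e else 0.
have v0 b : 0 <= v b by rewrite /v; case: b => //; exact: ltW.
pose pot := potential free_red (fun=> 0) v.
have pot0 c : 0 <= pot c.
  by apply: sumr_ge0 => y _; rewrite add0r mulr_ge0 // white_children_ge0.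
have gen0 n c : reach n c -> gen lambda rho (fun c => expR (- pot c)) c <= 0.
  move=> /reach_inv ci.
  have [rd|rnd] := eqVneq (c (Some [::])) Dead; last first.
    have p0 : pot c = 0.
      by apply: big1 => y _; rewrite /free_red (negbTE rnd) /= mulr0 addr0.
    rewrite -oppr_ge0 -mulN1r /gen -rate_sumZ; apply: rate_sum_ge0 => // u s.
    by rewrite p0 oppr0 expR0 mulN1r oppr_ge0 subr_le0 -expR0 ler_expR oppr_le0.
  have bu u : c (Some u) = Red -> (c (par u) == Blue) = false.
    by move=> ur; apply/negbTE/(root_dead_not_chased ci).
  have fd u y : free_red (flip c u Dead) y = (y != u) && free_red c y.
    rewrite /free_red !flipE rd if_same eqxx /=.
    by case: (y =P u).
  have fr y : free_red c y = (c (Some y) == Red) by rewrite /free_red rd eqxx.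
  apply: (@gen_exp_le0 _ _ _ _ lambda_gt0 rho_gt0 _ free_red id (fun=> 0) v
      free_red_infect free_red_new c (e * D)) => //.
  - by rewrite mulr_ge0 // ltW.
  - move=> u ur; rewrite /infect_cost /= /v fr ur eqxx add0r -/D.
    rewrite (_ : D * e - e = e * (D - 1)); last by ring.
    by rewrite ger0_norm ?mulr_ge0 // ?ltW // mulrBr; lra.
  - move=> u s ur [[_ pb]|->]; first by have := bu u ur; rewrite pb eqxx.
    have uc : u \in words c by rewrite mem_words ur.
    rewrite (perm_big _ (perm_to_rem uc)) /= big_cons big1_seq ?addr0; last first.
      move=> y /andP[_]; rewrite mem_rem_uniq ?words_uniq // inE => /andP[yu _].
      by rewrite fd yu /= /change !subrr mulr0 addr0 normr0.
    rewrite fd eqxx /= fr ur eqxx /change /v /= subrr add0r sub0r.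
    rewrite mulrN normrN ger0_norm; last by rewrite mulr_ge0 ?white_children_ge0 // ltW.
    by rewrite mulrC ler_pM2l // white_children_le.
  move=> y yw; have k0 := @white_children_ge0 R _ c y.
  set k := white_children c y in k0 *.
  rewrite [X in _ + X + _]big1 ?addr0; last first.
    by move=> u /eqP ur; rewrite bu // mul0r.
  rewrite (@split_sum d R c y (fun=> 0)) //; last first.
    move=> u uy; rewrite fd [y == u]eq_sym uy /= /change.
    by rewrite !subrr mulr0 addr0 normr0 mulr0 subr0.
  rewrite big1 // addr0 /drift /infect_cost /change fd eqxx /= fr -/k -/D.
  case: (c (Some y) == Red); last first.
    by rewrite /v /= !(subrr, mul0r, mulr0, normr0, addr0, add0r).
  rewrite /v /= !mul1r add0r subrr add0r sub0r mulrN normrN ger0_norm; last first.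
    by rewrite mulr_ge0 // ltW.
  have ke : 0 <= k * e by rewrite mulr_ge0 // ltW.
  have := ler_wpM2l ke eB; rewrite /B -/D; nra.
have genM n c K : reach n c ->
    lambda * ((0 < pot c) && (size (words c) < K)%N)%:R <=
    gen lambda rho (fun c => (minn (size (words c)) K)%:R) c.
  move=> rc; have mono m' : m' \in moves c ->
      (minn (size (words c)) K)%:R <=
      (minn (size (words (flip c m'.1 m'.2))) K)%:R :> R.
    move=> /size_words_move/andP[h _]; rewrite ler_nat leq_min geq_minr andbT.
    exact: leq_trans (geq_minl _ _) h.
  have [p0|p0] := boolP (0 < pot c); last first.
    by rewrite mulr0; apply: (gen_ge0 lambda_gt0 rho_gt0).
  have [KM|MK] := leqP K (size (words c)).
    by rewrite mulr0; apply: (gen_ge0 lambda_gt0 rho_gt0).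
  have [y [yw vy /white_children_gt0[i iw]]] := potential_gt0 v0 p0.
  have yr : c (Some y) = Red.
    by move: vy; rewrite /v /free_red; case: ifP => [/andP[_ /eqP]//|]; rewrite ltxx.
  have mm : (i :: y, Red) \in moves c.
    by rewrite mem_cat; apply/orP; left; apply/map_f/mem_frontier; exists i, y.
  have := gen_ge_move (phi := fun c => (minn (size (words c)) K)%:R)
    lambda_gt0 rho_gt0 mm mono.
  rewrite /= (perm_size (words_infect _ iw)) //=.
  by rewrite (minn_idPl MK) (minn_idPl (ltnW MK)) -natr1 addrAC subrr add0r.
(* The second jump is the first one that can kill the root while a child of it
   is red. *)
exists (1 - mean 2 (fun c => expR (- pot c))); last first.
  move=> K eps eps0.
  exact: (@likely_growth _ pot lambda 2 lambda_gt0 pot0 gen0 genM).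
rewrite subr_gt0.
have le1 c : expR (- pot c) <= 1 by rewrite -expR0 ler_expR oppr_le0.
pose i0 : 'I_d := Ordinal d_gt0.
have m1 : ([:: i0], Red) \in moves x0.
  rewrite mem_cat; apply/orP; left; apply/map_f/mem_frontier.
  by exists i0, [::]; rewrite !tree_initE.
pose c1 := flip x0 [:: i0] Red.
have r0 : reach 0 x0 by [].
have r1 : reach 1 c1.
  by exists x0 => //; exact: (move_nexts lambda_gt0 rho_gt0 r0 m1).
have m2 : ([::], Dead) \in moves c1.
  rewrite !mem_cat; apply/or3P; constructor 3; apply/map_f.
  by rewrite mem_reds flipE /= tree_initE.
have c2 : expR (- pot (flip c1 [::] Dead)) < 1.
  rewrite -expR0 ltr_expR oppr_lt0.
  have yc : [:: i0] \in words (flip c1 [::] Dead).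
    by rewrite mem_words !flipE /= ?eqxx.
  rewrite /pot /potential (perm_big _ (perm_to_rem yc)) /= big_cons add0r.
  rewrite ltr_pwDl //; last first.
    by apply: sumr_ge0 => y _; rewrite add0r mulr_ge0 // white_children_ge0.
  rewrite white_children_flip //; last by rewrite flipE /= tree_initE.
  rewrite white_children_new //; last by rewrite tree_initE.
    by rewrite /v /free_red !flipE /= ?eqxx /= mulr_gt0.
  exact: tree_inv_init.
have s1 : step q (@succ d) (fun c => expR (- pot c)) c1 < 1.
  exact: (step_move_lt lambda_gt0 rho_gt0 r1 m2 (fun c _ => le1 c) c2).
apply: (step_move_lt lambda_gt0 rho_gt0 r0 m1 _ s1) => z zn.
apply: (stepS_le fb (n := 1)) => //; first by exists x0.
Qed.

(** The descendants at depth at most [n]; only their finiteness, uniformly in the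
    configuration, matters. *)
Fixpoint short_words n : seq word :=
  if n is m.+1 then [::] :: [seq i :: z | i <- enum 'I_d, z <- short_words m]
  else [:: [::]].

Lemma mem_short_words n (z : word) : (size z <= n)%N -> z \in short_words n.
Proof.
elim: n z => [|n IH] [|i z] //= zn.
rewrite inE /=; apply/allpairsP; exists (i, z).
by rewrite mem_enum; split=> //; exact: IH.
Qed.

Lemma lev_red c y j : tree_inv c -> lev c y = Some j.+1 ->
  exists u, c (Some u) = Red /\ c (par u) = Blue.
Proof.
move=> ci; elim: y j => [|i y IH] j.
  rewrite levE /=; case e: (c (Some [::])) => //= _; exists [::]; split=> //.
  by have [] := ci.
rewrite levE /=; case e: (c (Some (i :: y))) => //=.
case ly: (lev c y) => [[|k]|] //= _; last exact: (IH k).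
by exists (i :: y); split=> //; apply/eqP; rewrite plev_blue //= ly.
Qed.

(** Weights that vanish at distances from [J] on make a single flip at [u] affect
    only the descendants of [u] at depth at most [J]. Their number is bounded, so
    for small [e] the slack [e * kappa] of the first order terms outweighs the
    quadratic ones, which are at most [e ^ 2 * B]. *)
Lemma blue_likely m : shoot (d := d) lambda 0 rho m < 0 -> exists2 delta, 0 < delta &
  forall K eps, 0 < eps -> exists n,
    delta - eps <= mean n (fun c => (K <= blues c)%N%:R).
Proof.
move=> /(subsolution d_gt0 lambda_gt0 (ltW rho_gt0)).
move=> [w [J [kappa [k0 [w0 w1 wpos wJ hw]]]]].
pose D := d%:R : R.
pose W := \sum_(i < J) w i.
have W0 : 0 <= W by apply: sumr_ge0.
have wW j : w j <= W.
  have [jJ|/wJ -> //] := ltnP j J.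
  by rewrite /W (bigD1 (Ordinal jJ)) //= lerDl sumr_ge0.
pose C := D * W * (size (short_words J))%:R.
have DW0 : 0 <= D * W by rewrite mulr_ge0.
have C0 : 0 <= C by rewrite mulr_ge0.
pose B := lambda * (D * W) ^+ 2 + C * W + rho * (J%:R * (C * W)).
have B0 : 0 <= B.
  by rewrite !addr_ge0 ?mulr_ge0 ?exprn_ge0 ?(ltW lambda_gt0) ?(ltW rho_gt0).
pose e := Num.min (1 / (4 * (1 + C + D * W))) (kappa / (1 + B)).
have Q0 : 0 < 1 + C + D * W by rewrite -addrA ltr_pwDl // addr_ge0.
have B10 : 0 < 1 + B by rewrite ltr_pwDl.
have e0 : 0 < e by rewrite lt_min !divr_gt0 ?mulr_gt0.
have eQ : e * (1 + C + D * W) <= 1 / 4.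
  rewrite -ler_pdivlMr //; apply: (@le_trans _ _ (1 / (4 * (1 + C + D * W)))).
    by rewrite ge_min lexx.
  by rewrite invfM mulrA !mul1r.
have eB : e * (1 + B) <= kappa.
  by rewrite -ler_pdivlMr // ge_min lexx orbT.
have eC : e * C <= 1 / 4 by have := mulr_ge0 (ltW e0) DW0; lra.
have eDW : e * (D * W) <= 1 / 4 by have := mulr_ge0 (ltW e0) C0; lra.
pose v (l : option nat) : R := oapp (fun j => e * w j) 0 l.
have v0 l : 0 <= v l by case: l => //= j; rewrite mulr_ge0 // ltW.
have veW l : v l <= e * W.
  by case: l => [j|] /=; [rewrite ler_pM2l|rewrite mulr_ge0 // ltW].
pose pot := potential (@lev d) (fun=> 0) v.
have pot0 c : 0 <= pot c.
  by apply: sumr_ge0 => y _; rewrite add0r mulr_ge0 // white_children_ge0.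
have gen0 n c : reach n c -> gen lambda rho (fun c => expR (- pot c)) c <= 0.
  move=> /reach_inv ci.
  apply: (@gen_exp_le0 _ _ _ _ lambda_gt0 rho_gt0 _ (@lev d) (omap S) (fun=> 0) v
      (@lev_infect d) (@lev_new d) c (e * C)) => //.
  - by rewrite mulr_ge0 // ltW.
  - move=> u ur; rewrite /infect_cost add0r -/D ler_norml.
    have h1 := v0 (lev c u); have h2 := v0 (omap S (lev c u)).
    have h3 := veW (lev c u); have h4 := veW (omap S (lev c u)).
    have D1 : 1 <= D by have := dR_ge2; rewrite -/D; lra.
    by apply/andP; split; nra.
  - move=> u s ur sBD.
    apply: (@le_trans _ _ (\sum_(y <- words c | y \in [seq z ++ u | z <- short_words J])
        (e * (D * W)))).
      rewrite [leRHS]big_mkcond; apply: ler_sum => y _.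
      set k := white_children c y.
      have k0' : 0 <= k by exact: white_children_ge0.
      have kD : k <= D by exact: white_children_le.
      rewrite /change subrr add0r.
      have [->|ne] := eqVneq (lev (flip c u s) y) (lev c y).
        by rewrite subrr mulr0 normr0; case: ifP => // _; rewrite mulr_ge0 // ltW.
      have [z [j [yz ly zj jz fl]]] := lev_change ci ur sBD ne.
      have [zJ|Jz] := leqP (size z) J.
        rewrite ifT; last first.
          by rewrite yz; apply: (map_f (fun z => z ++ u)); exact: mem_short_words.
        rewrite normrM (ger0_norm k0') mulrCA; apply: ler_pM => //.
        have h1 := v0 (lev c y); have h2 := v0 (lev (flip c u s) y).
        have h3 := veW (lev c y); have h4 := veW (lev (flip c u s) y).
        by rewrite ler_norml; lra.
      rewrite fl ly /v /=; have -> : w j = 0 by rewrite wJ // ltnW // (ltn_trans Jz).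
      have -> : oapp (fun j => e * w j) 0 (if s == Blue then Some (size z) else None) = 0.
        by case: ifP => //= _; rewrite wJ ?mulr0 // ltnW.
      by rewrite mulr0 subrr mulr0 normr0; case: ifP => // _; rewrite mulr_ge0 // ltW.
    rewrite sumr_const_seq /C -mulrA ler_pM2l // ler_wpM2l // ler_nat.
    rewrite -size_filter -[leqRHS](size_map (fun z => z ++ u)).
    apply: uniq_leq_size.
      by rewrite filter_uniq // words_uniq.
    by move=> y; rewrite mem_filter => /andP[].
  move=> y yw; have k0' := @white_children_ge0 R _ c y.
  set k := white_children c y in k0' *.
  rewrite (@capture_sum d R c y (fun a b => change (fun=> 0) v k a b -
      e * C * `|change (fun=> 0) v k a b|)) //; last first.
    by move=> a; rewrite /change !subrr mulr0 addr0 normr0 mulr0 subr0.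
  rewrite (@death_sum d R c y (fun a b => change (fun=> 0) v k a b -
      e * C * `|change (fun=> 0) v k a b|)) //; last first.
    by move=> a; rewrite /change !subrr mulr0 addr0 normr0 mulr0 subr0.
  rewrite /drift /infect_cost -/k -/D.
  case ly: (lev c y) => [[|j]|] /=; last 1 first.
  - by rewrite !(mulr0, addr0, add0r, subr0) expr2 !(mulr0, subr0, oppr0).
  - have -> : (c (Some y) == Red) = false.
      by move: ly; rewrite levE; case: (c (Some y)) => //=; case: (plev c y).
    by rewrite !(mul0r, mulr0, addr0).
  have -> : (c (Some y) == Red) = true.
    by move: ly; rewrite levE; case: (c (Some y)).
  rewrite mul1r /change /= !subrr !add0r.
  have [jJ|Jj] := ltnP j J; last first.
    rewrite !wJ ?(leqW Jj) ?(leqW (leqW Jj)) //.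
    by rewrite expr2 !(mulr0, subr0, add0r, normr0, addr0, oppr0).
  have hj := hw j jJ.
  have [a0 b0 c0'] := And3 (wpos j) (wpos j.+1) (wpos j.+2).
  have [aW bW cW] := And3 (wW j) (wW j.+1) (wW j.+2).
  move: (w j) (w j.+1) (w j.+2) hj a0 b0 c0' aW bW cW => a b c' hj a0 b0 c0' aW bW cW.
  have ke0 : 0 <= k * e by rewrite mulr_ge0 // ltW.
  have D1 : 1 <= D by have := dR_ge2; rewrite -/D; lra.
  have z2 : (D * (e * c') - e * b) ^+ 2 <= e ^+ 2 * (D * W) ^+ 2.
    rewrite -exprMn -[leLHS]real_normK ?num_real // ler_sqr ?nnegrE //; last first.
      by rewrite mulr_ge0 // ltW.
    rewrite ler_norml; have -> : D * (e * c') - e * b = e * (D * c' - b) by ring.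
    rewrite -mulrN !ler_pM2l //.
    have : D * c' <= D * W by rewrite ler_wpM2l // ltW.
    have : W <= D * W by rewrite ler_peMl.
    have : 0 <= D * c' by rewrite mulr_ge0 // ltW.
    by move=> *; apply/andP; split; lra.
  have n1 : `|k * (e * a - e * b)| <= k * e * W.
    rewrite normrM (ger0_norm k0') -mulrA ler_wpM2l // -mulrBr normrM gtr0_norm //.
    by rewrite ler_pM2l // ler_norml; lra.
  have n2 : `|k * - (e * b)| <= k * e * W.
    rewrite mulrN normrN ger0_norm ?mulr_ge0 // ?(ltW e0) // mulrA.
    by rewrite ler_wpM2l.
  have eC0 : 0 <= e * C by rewrite mulr_ge0 // ltW.
  have m1 := ler_wpM2l eC0 n1.
  have m2 := ler_wpM2l eC0 n2.
  have jJR : j.+1%:R <= J%:R :> R by rewrite ler_nat.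
  have m3 : rho * (j.+1%:R * (e * C * `|k * - (e * b)|)) <=
      rho * (J%:R * (e * C * (k * e * W))).
    by rewrite ler_pM2l //; apply: ler_pM => //; rewrite mulr_ge0.
  have m4 : lambda * (k * (D * (e * c') - e * b) ^+ 2) <=
      lambda * (k * (e ^+ 2 * (D * W) ^+ 2)).
    by rewrite ler_pM2l // ler_wpM2l.
  have m5 := ler_wpM2l ke0 hj.
  have m6 := ler_wpM2l ke0 eB.
  have m7 := mulr_ge0 ke0 (ltW e0).
  move: m1 m3 m4 m5 m6 m7; rewrite /B.
  move: `|k * (e * a - e * b)| `|k * - (e * b)| => x1 x2.
  rewrite -/D => m1 m3 m4 m5 m6 m7.
  rewrite -subr_ge0 in m1; rewrite -subr_ge0 in m3; rewrite -subr_ge0 in m4.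
  rewrite -subr_ge0 in m5; rewrite -subr_ge0 in m6.
  lra.
have genM n c K : reach n c ->
    1 * ((0 < pot c) && (blues c < K)%N)%:R <=
    gen lambda rho (fun c => (minn (blues c) K)%:R) c.
  move=> rc; have ci := reach_inv rc.
  have mono m' : m' \in moves c ->
      (minn (blues c) K)%:R <= (minn (blues (flip c m'.1 m'.2)) K)%:R :> R.
    move=> mm; rewrite ler_nat leq_min geq_minr andbT.
    apply: leq_trans (geq_minl _ _) _; apply: (blues_incr rc).
    exact: (move_nexts lambda_gt0 rho_gt0 rc mm).
  have [p0|p0] := boolP (0 < pot c); last first.
    by rewrite mulr0; apply: (gen_ge0 lambda_gt0 rho_gt0).
  have [KM|MK] := leqP K (blues c).
    by rewrite mulr0; apply: (gen_ge0 lambda_gt0 rho_gt0).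
  have [y [yw vy _]] := potential_gt0 v0 p0.
  have [u [ur ub]] : exists u, c (Some u) = Red /\ c (par u) = Blue.
    move: vy; case ly: (lev c y) => [[|j]|] /=; rewrite /v /= ?w0 ?mulr0 ?ltxx //.
    by move=> _; exact: (lev_red ci ly).
  have mm : (u, Blue) \in moves c.
    rewrite !mem_cat; apply/or3P; constructor 2; apply/map_f.
    by rewrite mem_filter mem_reds ur ub.
  have := gen_ge_move (phi := fun c => (minn (blues c) K)%:R)
    lambda_gt0 rho_gt0 mm mono.
  rewrite /= blues_flip ?ur //= add1n.
  by rewrite (minn_idPl MK) (minn_idPl (ltnW MK)) -natr1 addrAC subrr add0r.
exists (1 - mean 0 (fun c => expR (- pot c))); last first.
  move=> K eps eps0.
  exact: (@likely_growth _ pot 1 0 ltr01 pot0 gen0 genM).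
rewrite subr_gt0 -[mean 0 _]/(expR (- pot x0)) -expR0 ltr_expR oppr_lt0.
rewrite /pot potential_init lev_init /= add0r.
by rewrite mulr_gt0 // mulr_gt0.
Qed.

End Means.

(** * Escape, coexistence and the phase diagram *)

Section UnionSeq.
Local Open Scope classical_set_scope.

Lemma infinite_union_seq (T : choiceType) (L : nat -> seq T) :
  (forall n, uniq (L n)) -> (forall n, {subset L n <= L n.+1}) ->
  infinite_set [set x | exists n, x \in L n] <->
  (forall K, exists n, (K <= size (L n))%N).
Proof.
move=> uL Lsub.
have Lle n m : (n <= m)%N -> {subset L n <= L m}.
  elim: m => [|m IH]; first by rewrite leqn0 => /eqP ->.
  rewrite leq_eqVlt ltnS => /predU1P[-> //|/IH h] x /h; exact: Lsub.
split=> [inf K|big].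
  have [B BL KB] := infinite_set_fset K inf.
  have [n Bn] : exists n, {subset enum_fset B <= L n}.
    have : forall x, x \in enum_fset B -> exists n, x \in L n by move=> x /BL.
    elim: (enum_fset B) => [|x s IH] H; first by exists 0%N.
    have [|n1 h1] := IH; first by move=> y ys; apply: H; rewrite inE ys orbT.
    have [|n2 h2] := H x; first by rewrite inE eqxx.
    exists (maxn n1 n2) => y; rewrite inE => /predU1P[->|/h1].
      exact: Lle (leq_maxr _ _) _ h2.
    exact: Lle (leq_maxl _ _) _.
  exists n; apply: leq_trans KB _; apply: uniq_leq_size Bn; exact: fset_uniq.
move=> /finite_seqP[s sE]; have [n] := big (size s).+1; apply/negP; rewrite -leqNgt.
apply: uniq_leq_size => // x xn.
have : [set x | exists n, x \in L n] x by exists n.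
by rewrite sE.
Qed.

End UnionSeq.

Section Events.
Local Open Scope classical_set_scope.
Context {R : realType} {d : nat}.
Variables lambda rho : R.
Hypothesis d_ge2 : (2 <= d)%N.
Hypothesis lambda_gt0 : 0 < lambda.
Hypothesis rho_gt0 : 0 < rho.
Local Notation word := (seq 'I_d).
Local Notation conf := (config (tvertex d)).
Local Notation q := (ced_rate (@tadj d) lambda rho).
Local Notation x0 := (tree_init d).
Context {disp : measure_display} {Omega : measurableType disp}.
Variables (P : probability Omega R) (X : R -> Omega -> conf).
Hypothesis HX : is_CED lambda rho P X.

Let fb := @ced_finite_branching R d lambda rho lambda_gt0 rho_gt0.

Section Path.
Variables (w : Omega) (Z : nat -> conf).
Hypothesis Z0 : Z 0%N = x0.
Hypothesis ZS : forall n, Z n.+1 \in nexts q (@succ d) (Z n).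
Hypothesis ZX : forall D : pred conf,
  (exists2 t : R, 0 <= t & D (X t w)) <-> (exists n, D (Z n)).

Let rZ n : reach q (@succ d) x0 n (Z n).
Proof. by elim: n => [|n IH] //; exists (Z n). Qed.

Let everE s : ever X s w = [set v | exists n, Z n v = s].
Proof.
apply/seteqP; split=> v /=.
  move=> [t t0 /eqP ht].
  by have [n /eqP] := (ZX (fun c => c v == s)).1 (ex_intro2 _ _ t t0 ht); exists n.
move=> [n /eqP hn]; have [t t0 /eqP ht] := (ZX (fun c => c v == s)).2 (ex_intro _ n hn).
by exists t.
Qed.

Let stable n u : Z n (Some u) != White -> Z n.+1 (Some u) != White /\
  (Z n (Some u) = Blue -> Z n.+1 (Some u) = Blue).
Proof.
move=> uw; have [->|[m mm ->]] := mem_nexts (ZS n); first by [].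
have [s0 us] := moves_change mm; rewrite flipE; case: (u =P m.1) => // e.
split=> // ub; move: mm => /mem_moves; rewrite -e ub.
by case=> [[_]|[_]|[_]].
Qed.

Let born_red n u : Z n (Some u) != White -> exists m, Z m (Some u) = Red.
Proof.
elim: n => [|n IH].
  by move=> uw; exists 0%N; move: uw; rewrite Z0 tree_initE; case: ifP.
have [uw|/IH//] := eqVneq (Z n (Some u)) White.
move=> un; exists n.+1; move: un; have [->|[m mm ->]] := mem_nexts (ZS n).
  by rewrite uw.
rewrite flipE; case: (u =P m.1) => [e _|_]; last by rewrite uw.
by move: mm => /mem_moves; rewrite -e uw => -[[->]|[_]|[_]].
Qed.

(** Every vertex that has left the state white was red at some time. *)
Lemma infinite_red : infinite_set (ever X Red w) <->
  (forall K, exists n, (K <= size (words (Z n)))%N).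
Proof.
have -> : ever X Red w = [set v | exists n, v \in [seq Some u | u <- words (Z n)]].
  rewrite everE; apply/seteqP; split=> -[u|] /= [n hn].
  - by exists n; apply: map_f; rewrite mem_words hn.
  - by have [c0 _ _ _] := reach_inv (rZ n); rewrite c0 in hn.
  - move: hn => /mapP[u' + [->]]; rewrite mem_words; exact: born_red.
  - by move: hn => /mapP[].
rewrite infinite_union_seq.
- by split=> h K; have [n hn] := h K; exists n; move: hn; rewrite size_map.
- by move=> n; rewrite map_inj_uniq ?words_uniq // => ? ? [].
- move=> n v /mapP[u uw ->]; apply: map_f; move: uw; rewrite !mem_words.
  by move=> /stable[].
Qed.

Lemma infinite_blue : infinite_set (ever X Blue w) <->
  (forall K, exists n, (K <= blues (Z n))%N).
Proof.
have -> : ever X Blue w = [set v | exists n, v \in None ::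
    [seq Some u | u <- [seq u <- words (Z n) | Z n (Some u) == Blue]]].
  rewrite everE; apply/seteqP; split=> -[u|] /= [n hn].
  - exists n; rewrite inE /=; apply: map_f.
    by rewrite mem_filter mem_words hn.
  - by exists n; rewrite inE.
  - move: hn; rewrite inE /= => /mapP[u' + [->]]; rewrite mem_filter => /andP[/eqP h _].
    by exists n.
  - by exists 0%N; rewrite Z0 tree_init_None.
rewrite infinite_union_seq.
- split=> h K; have [n hn] := h K.+1; exists n; move: hn;
    rewrite /= size_map size_filter //.
  by move=> /ltnW /leqW.
- move=> n /=; apply/andP; split; first by apply/negP => /mapP[].
  by rewrite map_inj_uniq ?filter_uniq ?words_uniq // => ? ? [].
- move=> n v; rewrite !inE => /predU1P[->|/mapP[u uw ->]]; first by rewrite eqxx.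
  apply/orP; right; apply: map_f; move: uw; rewrite !mem_filter !mem_words.
  by move=> /andP[/eqP ub /stable[-> /(_ ub) ->]].
Qed.

End Path.

Let prob_le (E : set Omega) (M : conf -> nat) : measurable E ->
  (forall w (Z : nat -> conf), Z 0%N = x0 ->
     (forall n, Z n.+1 \in nexts q (@succ d) (Z n)) ->
     (forall D : pred conf,
       (exists2 t : R, 0 <= t & D (X t w)) <-> (exists n, D (Z n))) ->
     E w <-> (forall K, exists n, (K <= M (Z n))%N)) ->
  (forall n c y, reach q (@succ d) x0 n c -> y \in nexts q (@succ d) c ->
     (M c <= M y)%N) ->
  (forall eps, 0 < eps -> exists K, forall n,
     mean q (@succ d) x0 n (fun c => (K <= M c)%N%:R) <= eps) ->
  P E = 0%E.
Proof.
move=> mE ME Minc small; have [Y [H [mY mH H0 pX law]]] := HX.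
apply/eqP; rewrite -measure_le0.
apply: (prob_unbounded_le fb mY mH H0 pX law mE ME Minc) => eps /small[K hK].
by exists K => n; rewrite add0r.
Qed.

Let prob_gt (E : set Omega) (M : conf -> nat) : measurable E ->
  (forall w (Z : nat -> conf), Z 0%N = x0 ->
     (forall n, Z n.+1 \in nexts q (@succ d) (Z n)) ->
     (forall D : pred conf,
       (exists2 t : R, 0 <= t & D (X t w)) <-> (exists n, D (Z n))) ->
     E w <-> (forall K, exists n, (K <= M (Z n))%N)) ->
  (exists2 delta, 0 < delta & forall K eps, 0 < eps -> exists n,
    delta - eps <= mean q (@succ d) x0 n (fun c => (K <= M c)%N%:R)) ->
  (0 < P E)%E.
Proof.
move=> mE ME [delta d0 large]; have [Y [H [mY mH H0 pX law]]] := HX.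
apply: (@lt_le_trans _ _ delta%:E); first by rewrite lte_fin.
exact: (prob_unbounded_ge fb mY mH H0 pX law mE ME large).
Qed.

(** A set of vertices is infinite when it contains vertices of arbitrarily large
    code. *)
Lemma measurable_infinite s : measurable [set w | infinite_set (ever X s w)].
Proof.
have [Y [H [mY mH H0 pX law]]] := HX.
have -> : [set w | infinite_set (ever X s w)] = \bigcap_(k : nat) \bigcup_(v : tvertex d)
    (if (k <= choice.pickle v)%N then [set w | exists2 t : R, 0 <= t & X t w v == s]
     else set0).
  apply/seteqP; split=> w /=.
    move=> inf k _; apply: contrapT => no; apply: inf.
    apply: (@sub_finite_set _ _
        [set` pmap (@choice.unpickle (tvertex d)) (iota 0 k)]); last exact: finite_seq.
    move=> v [t t0 tv]; rewrite /= mem_pmap; apply/mapP; exists (choice.pickle v).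
      rewrite mem_iota add0n ltnNge; apply/negP => kv; apply: no.
      by exists v => //; rewrite kv; exists t; rewrite // tv.
    by rewrite choice.pickleK.
  move=> all fin; have /finite_seqP[l lE] := fin.
  have [v _] := all (\max_(v <- l) choice.pickle v).+1 I.
  case: ifPn => // lv [t t0 /eqP tv].
  have : ever X s w v by exists t.
  rewrite lE /= => vl; move: lv; rewrite ltnNge => /negP; apply.
  exact: leq_bigmax_seq.
apply: bigcapT_measurable => k; apply: countable_bigcupT_measurable => [|v].
  exact: countableP.
case: ifP => // _.
exact: (measurable_visits mY mH H0 pX (fun c => c v == s)).
Qed.

Lemma red_dies : lambda * (d%:R - 1) <= rho -> P (eventA X) = 0%E.
Proof.
move=> h; apply: (prob_le (M := fun c => size (words c))).
- exact: measurable_infinite.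
- by move=> w Z Z0 ZS ZX; exact: infinite_red Z0 ZS ZX.
- exact: size_words_incr.
- by move=> eps; exact: red_rare.
Qed.

Lemma red_survives : rho < lambda * (d%:R - 1) -> (0 < P (eventA X))%E.
Proof.
move=> h; apply: (prob_gt (M := fun c => size (words c))).
- exact: measurable_infinite.
- by move=> w Z Z0 ZS ZX; exact: infinite_red Z0 ZS ZX.
- exact: red_likely.
Qed.

Lemma blue_dies : viable (d := d) lambda rho -> P (eventB X) = 0%E.
Proof.
move=> h; apply: (prob_le (M := blues (d := d))).
- exact: measurable_infinite.
- by move=> w Z Z0 ZS ZX; exact: infinite_blue Z0 ZS ZX.
- exact: blues_incr.
- by move=> eps; exact: blue_rare.
Qed.

Lemma blue_survives m : shoot (d := d) lambda 0 rho m < 0 -> (0 < P (eventB X))%E.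
Proof.
move=> h; apply: (prob_gt (M := blues (d := d))).
- exact: measurable_infinite.
- by move=> w Z Z0 ZS ZX; exact: infinite_blue Z0 ZS ZX.
- exact: blue_likely h.
Qed.

End Events.

Section Infimum.
Local Open Scope classical_set_scope.

Lemma inf_ge (R : realType) (a : R) : inf [set x | a <= x] = a.
Proof.
apply/le_anti/andP; split; first by apply: ge_inf; [exists a|rewrite /= lexx].
by apply: lb_le_inf; [exists a; rewrite /= lexx|].
Qed.

Lemma inf_gt0 (R : realType) : inf [set x : R | 0 < x] = 0.
Proof.
apply/le_anti/andP; split; last first.
  by apply: lb_le_inf; [exists 1; rewrite /= ltr01|move=> x /ltW].
rewrite leNgt; apply/negP => i0.
have : inf [set x : R | 0 < x] <= inf [set x : R | 0 < x] / 2.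
  by apply: ge_inf; [exists 0 => x /ltW|rewrite /= divr_gt0].
lra.
Qed.

End Infimum.

(** The open interval is where the characteristic polynomial of the recurrence at
    [rho = 0] has no real root. *)
Lemma lambda_window (R : realType) (d : nat) (lambda : R) : (1 <= d)%N ->
  (lambda_cminus R d < lambda < lambda_cplus R d) =
  ((1 + lambda) ^+ 2 < 4 * d%:R * lambda).
Proof.
move=> d1; rewrite /lambda_cminus /lambda_cplus; set D := d%:R : R.
have D1 : 1 <= D by rewrite ler1n.
have sD : 0 <= D ^+ 2 - D by nra.
have := sqr_sqrtr sD; have := sqrtr_ge0 (D ^+ 2 - D).
set s := Num.sqrt _ => s0 ss.
apply/idP/idP => [/andP[h1 h2]|h]; first by nra.
by apply/andP; split; rewrite ltNge; apply/negP => h'; nra.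
Qed.

Theorem theorem1 (R : realType) (d : nat) (lambda : R)
  (hd : (2 <= d)%N) (hlambda : 0 < lambda)
  (disp : R -> measure_display)
  (Omega : forall rho : R, measurableType (disp rho))
  (P : forall rho : R, probability (Omega rho) R)
  (X : forall rho : R, R -> Omega rho -> config (tvertex d))
  (hX : forall rho : R, 0 < rho -> is_CED lambda rho (P rho) (X rho)) :
  let PA := fun rho : R => P rho (eventA (X rho)) in
  let PB := fun rho : R => P rho (eventB (X rho)) in
  let rho_c := critical_value PB in
  let rho_e := critical_value PA in
  (lambda_cminus R d < lambda < lambda_cplus R d ->
     [/\ 0 < rho_c, rho_c < rho_e, rho_e = lambda * (d%:R - 1),
         (0 < PA rho_c)%E /\ PB rho_c = 0%E & PA rho_e = 0%E])
  /\
  (~~ (lambda_cminus R d < lambda < lambda_cplus R d) ->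
     [/\ rho_c = 0, 0 < rho_e, rho_e = lambda * (d%:R - 1)
       & PA rho_e = 0%E]).
Proof.
move=> PA PB rho_c rho_e.
have d1 : (1 <= d)%N by apply: leq_trans hd.
have dR : 2 <= d%:R :> R by rewrite ler_nat.
have e0 : 0 < lambda * (d%:R - 1) by rewrite mulr_gt0 //; lra.
have rho_eE : rho_e = lambda * (d%:R - 1).
  rewrite -[RHS]inf_ge; congr inf; apply/seteqP; split=> r /=.
    move=> [r0 hr]; rewrite leNgt; apply/negP => h.
    by have := red_survives hd hlambda r0 (hX _ r0) h; rewrite -/(PA r) hr ltxx.
  move=> h; have r0 : 0 < r by apply: lt_le_trans h.
  by split=> //; exact: red_dies (hX _ r0) h.
have PAe : PA rho_e = 0%E.
  by rewrite rho_eE; apply: (red_dies hd hlambda e0 (hX _ e0)).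
have viableE r : 0 < r -> PB r = 0%E <-> viable (d := d) lambda r.
  move=> r0; split=> [hr n|]; last exact: blue_dies (hX _ r0).
  rewrite leNgt; apply/negP => h.
  by have := blue_survives hd hlambda r0 (hX _ r0) h; rewrite -/(PB r) hr ltxx.
have rho_cE : rho_c = inf [set r | 0 < r /\ viable (d := d) lambda r]%classic.
  congr inf; apply/seteqP; split=> r /= [r0 hr]; split=> //.
    exact: (viableE r r0).1.
  exact: (viableE r r0).2.
have lbc : has_lbound [set r | 0 < r /\ viable (d := d) lambda r]%classic.
  by exists 0 => r [/ltW].
rewrite lambda_window //; split=> [win|].
  pose r' := 3 / 4 * (lambda * (d%:R - 1)).
  have r'0 : 0 < r' by rewrite mulr_gt0 // divr_gt0.
  have vr' : viable (d := d) lambda r'.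
    apply: viable_sufficient => //; first exact: ltW.
    rewrite /r'; move: (d%:R : R) dR => D D2; rewrite -subr_ge0.
    (* As a quadratic polynomial in [lambda], the difference of the two sides has
       a negative discriminant. *)
    have h : 0 <= (1 + (3 / 4 * D + 1 / 4) * (3 / 2 * D - 1 / 2) * lambda ^+ 2
        - (7 / 4 * D + 1 / 4) * lambda).
      have q1 : (7 / 4 * D + 1 / 4) ^+ 2 <=
          4 * ((3 / 4 * D + 1 / 4) * (3 / 2 * D - 1 / 2)) by nra.
      have := sqr_ge0 (1 - (7 / 4 * D + 1 / 4) / 2 * lambda).
      have := ler_wpM2r (sqr_ge0 lambda) q1.
      by lra.
    by lra.
  have [n] := not_viable0 d1 hlambda win.
  move=> /(shoot_near_rho (d := d) (lambda := lambda))[delta delta0 hdelta].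
  have ce : rho_c <= r' by rewrite rho_cE; apply: ge_inf.
  have c0 : 0 < rho_c.
    apply: lt_le_trans delta0 _; rewrite rho_cE; apply: lb_le_inf; first by exists r'.
    move=> r [r0 vr]; rewrite leNgt; apply/negP => rd.
    have := hdelta r; rewrite subr0 gtr0_norm // => /(_ rd).
    by rewrite ltNge vr.
  have lt_ce : rho_c < rho_e by apply: le_lt_trans ce _; rewrite rho_eE /r'; lra.
  split=> //; split.
    by apply: (red_survives hd hlambda c0 (hX _ c0)); rewrite -rho_eE.
  apply/(viableE _ c0) => m; rewrite leNgt; apply/negP.
  move=> /(shoot_near_rho (d := d) (lambda := lambda))[eps eps0 heps].
  have hi : has_inf [set r | 0 < r /\ viable (d := d) lambda r]%classic.
    by split=> //; exists r'.
  have [r [r0 vr] rlt] := inf_adherent eps0 hi.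
  have rge : rho_c <= r by rewrite rho_cE; apply: ge_inf.
  have rl : `|r - rho_c| < eps.
    by rewrite ger0_norm ?subr_ge0 // ltrBlDl rho_cE.
  by have := heps r rl; rewrite ltNge vr.
rewrite -leNgt => nwin; split=> //; last by rewrite rho_eE.
rewrite rho_cE -[RHS](inf_gt0 R); congr inf; apply/seteqP; split=> r /=; first by case.
move=> r0; split=> //; apply: viable_sufficient => //; first exact: ltW.
by apply: le_trans nwin _; nra.
Qed.
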